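(* Let $b_+,b_->0$, $\delta_\pm\in\mathbb R$ with $b_\pm+\delta_\pm>0$, and $c>0$, and suppose these parameters are such that $0$ is a two-fold eigenvalue (two-dimensional eigenspace) of the type-I interface Hamiltonian $\hat H_{\mathrm I}(0)$ defined in the context. Then there is a positive real constant $E^{(1)}_{\mathrm I}$, determined by $(b_\pm,\delta_\pm,c)$, such that for all sufficiently small $k\neq 0$ the operator $\hat H_{\mathrm I}(k)$ has two distinct eigenvalues $E_{\mathrm I,+}(k)$, $E_{\mathrm I,-}(k)$ near $0$ satisfying $$E_{\mathrm I,\pm}(k)=\pm E^{(1)}_{\mathrm I}|k|+\mathcal O(k^2).$$
   Context: Coefficients: for $n\in\mathbb Z$ let $b_n=b_+$ for $n\ge0$ and $b_n=b_-$ for $n\le -1$; $c_n=b_++\delta_+$ for $n\ge 0$, $c_{-1}=c$, $c_n=b_-+\delta_-$ for $n\le-2$; $d_n=b_++\delta_+$ for $n\ge0$, $d_n=b_-+\delta_-$ for $n\le -1$. For $k\in[-\pi,\pi)$, $\hat H_{\mathrm I}(k)$ is the bounded self-adjoint operator on $\ell^2(\mathbb Z;\mathbb C^6)$ acting on $u=\{(u_{j,n})_{j=1}^6\}_{n\in\mathbb Z}$ by $(\hat H_{\mathrm I}(k)u)_{1,n}=-b_nu_{4,n}-b_nu_{5,n}-c_{n-1}e^{-ik}u_{6,n-1}$, $(\hat H_{\mathrm I}(k)u)_{2,n}=-b_nu_{4,n}-d_ne^{ik}u_{5,n}-b_nu_{6,n}$, $(\hat H_{\mathrm I}(k)u)_{3,n}=-c_nu_{4,n+1}-b_nu_{5,n}-b_nu_{6,n}$,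 $(\hat H_{\mathrm I}(k)u)_{4,n}=-b_nu_{1,n}-b_nu_{2,n}-c_{n-1}u_{3,n-1}$, $(\hat H_{\mathrm I}(k)u)_{5,n}=-b_nu_{1,n}-d_ne^{-ik}u_{2,n}-b_nu_{3,n}$, $(\hat H_{\mathrm I}(k)u)_{6,n}=-c_ne^{ik}u_{1,n+1}-b_nu_{2,n}-b_nu_{3,n}$. *)

(* Defs.v *)
From Stdlib Require Import Reals ZArith.
From Coquelicot Require Import Coquelicot.
Open Scope R_scope.

Inductive Idx : Set := I1 | I2 | I3 | I4 | I5 | I6.

(* A state u = (u_{j,n}) : u n j. *)
Definition state := Z -> Idx -> C.

Definition bcoef (bp bm : R) (n : Z) : R := if (0 <=? n)%Z then bp else bm.
Definition ccoef (bp bm dp dm c : R) (n : Z) : R :=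
  if (0 <=? n)%Z then bp + dp else if (n =? -1)%Z then c else bm + dm.
Definition dcoef (bp bm dp dm : R) (n : Z) : R :=
  if (0 <=? n)%Z then bp + dp else bm + dm.

Definition expi (k : R) : C := (cos k, sin k).

Definition HI (bp bm dp dm c k : R) (u : state) : state :=
  fun n j =>
  let b := RtoC (bcoef bp bm n) in
  let cn := RtoC (ccoef bp bm dp dm c n) in
  let cn1 := RtoC (ccoef bp bm dp dm c (n - 1)) in
  let d := RtoC (dcoef bp bm dp dm n) in
  match j with
  | I1 => (- b * u n I4 - b * u n I5 - cn1 * expi (- k) * u (n - 1)%Z I6)%C
  | I2 => (- b * u n I4 - d * expi k * u n I5 - b * u n I6)%C
  | I3 => (- cn * u (n + 1)%Z I4 - b * u n I5 - b * u n I6)%C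
  | I4 => (- b * u n I1 - b * u n I2 - cn1 * u (n - 1)%Z I3)%C
  | I5 => (- b * u n I1 - d * expi (- k) * u n I2 - b * u n I3)%C
  | I6 => (- cn * expi k * u (n + 1)%Z I1 - b * u n I2 - b * u n I3)%C
  end.

Definition site_nsq (u : state) (n : Z) : R :=
  Cmod (u n I1) ^ 2 + Cmod (u n I2) ^ 2 + Cmod (u n I3) ^ 2
  + Cmod (u n I4) ^ 2 + Cmod (u n I5) ^ 2 + Cmod (u n I6) ^ 2.

Definition in_l2 (u : state) : Prop :=
  ex_series (fun m : nat => site_nsq u (Z.of_nat m) + site_nsq u (- Z.of_nat m - 1)%Z).

Definition nonzero_state (u : state) : Prop := exists n j, u n j <> RtoC 0.

Definition is_eigenvalue (bp bm dp dm c k E : R) : Prop :=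
  exists u : state, in_l2 u /\ nonzero_state u /\
    forall n j, HI bp bm dp dm c k u n j = (RtoC E * u n j)%C.

Definition in_eigenspace (bp bm dp dm c k E : R) (u : state) : Prop :=
  in_l2 u /\ forall n j, HI bp bm dp dm c k u n j = (RtoC E * u n j)%C.

Definition eigenspace_dim2 (bp bm dp dm c k E : R) : Prop :=
  exists u1 u2 : state,
    in_eigenspace bp bm dp dm c k E u1 /\ in_eigenspace bp bm dp dm c k E u2 /\
    (forall a1 a2 : C, (forall n j, (a1 * u1 n j + a2 * u2 n j)%C = RtoC 0) ->
        a1 = RtoC 0 /\ a2 = RtoC 0) /\
    (forall u, in_eigenspace bp bm dp dm c k E u ->
        exists a1 a2 : C, forall n j, u n j = (a1 * u1 n j + a2 * u2 n j)%C).

(* Main.v *)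
Require Import Defs.
From Stdlib Require Import Reals ZArith Lra Lia ClassicalEpsilon Ranalysis5.
From Coquelicot Require Import Coquelicot.
Open Scope R_scope.

(** After the gauge change u_n -> exp(-ikn/2) u_n, the exchange of the sites j and
    j+3 followed by complex conjugation commutes with the Hamiltonian. Eigenvectors
    with u_{j+3} = conj(u_j) solve the scalar chain equation
      E v_m + a_m conj(v_m) + b_m conj(v_{m+1}) + b_{m-1} conj(v_{m-1}) = 0,
    and the left half of the chain is the mirror image of a right half. Solutions
    decaying on a half-line satisfy -b_{m-1} conj(v_{m-1}) = g_m v_m + h_m conj(v_m)
    with g_m real, and the pairs (g_m, h_m) obey the Riccati recursion
      g_m = E + |b_m|^2 g_{m+1} / D,  h_m = a_m - b_m^2 conj(h_{m+1}) / D,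
      D = |h_{m+1}|^2 - g_{m+1}^2.
    At E = k = 0 the given zero mode is a Bloch mode with multiplier 0 < lam < 1 on
    each side and provides a periodic solution g = 0, h real, at which the recursion
    over one cell has differential lam^2. The implicit function theorem continues it
    to small (E, k), with g = gamma E and Im h = eta k to first order. Matching both
    halves through the interface bond gives a pair (G, H) with G = Gamma E,
    H = i Theta k to first order, and E is an eigenvalue as soon as G = |H|, an
    equation solved by the intermediate value theorem near E = (Theta / Gamma) |k|.
    Theta is a sum of terms b (x^2 + z^2 - y (x + z)), with (x, y, z) the zero mode
    in one cell; they are positive because d y = - b (x + z). Changing the sign of
    u_4, u_5, u_6 turns E into -E. *)

(** * Strict differentiability and implicit functions *)

(** A pointed space of parameters. [padd] adjoins one real unknown at a time, so a single
    one-unknown implicit function theorem serves at every stage of an elimination. *)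
Record pspace := PSpace {
  pt :> Type;
  pd : pt -> pt -> R;
  po : pt;
  pd_ge0 : forall z z', 0 <= pd z z';
  pd_refl : forall z, pd z z = 0 }.
Arguments pd {_} _ _.
Arguments po {_}.

Definition Rspace : pspace :=
  PSpace R (fun x y => Rabs (x - y)) 0 (fun x y => Rabs_pos (x - y))
    (fun x => eq_trans (f_equal Rabs (Rminus_diag x)) Rabs_R0).

Lemma padd_ge0 (S : pspace) (p q : S * R) :
  0 <= pd (fst p) (fst q) + Rabs (snd p - snd q).
Proof. pose proof (pd_ge0 S (fst p) (fst q)); pose proof (Rabs_pos (snd p - snd q)); lra. Qed.

Lemma padd_refl (S : pspace) (p : S * R) :
  pd (fst p) (fst p) + Rabs (snd p - snd p) = 0.
Proof. rewrite pd_refl, Rminus_diag, Rabs_R0; ring. Qed.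

Definition padd (S : pspace) : pspace :=
  PSpace (S * R) (fun p q => pd (fst p) (fst q) + Rabs (snd p - snd q))
    (po, 0) (padd_ge0 S) (padd_refl S).

Definition near (S : pspace) (P : S -> Prop) : Prop :=
  exists r, 0 < r /\ forall z : S, pd z po < r -> P z.

Lemma near_and (S : pspace) (P Q : S -> Prop) :
  near S P -> near S Q -> near S (fun z => P z /\ Q z).
Proof.
  intros [r [r0 Hr]] [s [s0 Hs]]; exists (Rmin r s); split.
  - now apply Rmin_glb_lt.
  - intros z Hz; pose proof (Rmin_l r s); pose proof (Rmin_r r s).
    split; [apply Hr | apply Hs]; lra.
Qed.

Lemma near_imp (S : pspace) (P Q : S -> Prop) :
  (forall z, P z -> Q z) -> near S P -> near S Q.
Proof. intros H [r [r0 Hr]]; exists r; split; auto. Qed.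

(* Strict differentiability at the base point with a quadratic remainder. Only
   the increments of L matter, so L need not be linear and S needs no vector
   space structure. *)
Definition strict_diff (S : pspace) (f : S -> R) (f0 : R) (L : S -> R) : Prop :=
  f po = f0 /\
  (exists M, 0 <= M /\ forall z z', Rabs (L z - L z') <= M * pd z z') /\
  exists K r, 0 <= K /\ 0 < r /\ forall z z', pd z po < r -> pd z' po < r ->
    Rabs (f z - f z' - (L z - L z')) <= K * (pd z po + pd z' po) * pd z z'.

Lemma strict_diff_ext (S : pspace) (f f' : S -> R) (f0 f0' : R) (L L' : S -> R) :
  (forall z, f z = f' z) -> f0 = f0' -> (forall z, L z = L' z) ->
  strict_diff S f f0 L -> strict_diff S f' f0' L'.
Proof.
  intros Hf <- HL [H0 [[M [M0 HM]] [K [r [K0 [r0 H]]]]]]; split; [|split].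
  - now rewrite <- Hf.
  - exists M; split; auto; intros; rewrite <- !HL; auto.
  - exists K, r; repeat split; auto; intros; rewrite <- !HL, <- !Hf; auto.
Qed.

Lemma strict_diff_lipschitz (S : pspace) (f : S -> R) f0 L :
  strict_diff S f f0 L ->
  exists K r, 0 <= K /\ 0 < r /\ forall z z', pd z po < r -> pd z' po < r ->
    Rabs (f z - f z') <= K * pd z z'.
Proof.
  intros [_ [[M [M0 HM]] [K [r [K0 [r0 H]]]]]].
  exists (M + K * (2 * r)), r; repeat split; auto; [nra|].
  intros z z' Hz Hz'; specialize (H z z' Hz Hz'); specialize (HM z z').
  pose proof (pd_ge0 S z z'); pose proof (pd_ge0 S z po); pose proof (pd_ge0 S z' po).
  replace (f z - f z') with ((f z - f z' - (L z - L z')) + (L z - L z')) by ring.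
  eapply Rle_trans; [apply Rabs_triang|].
  assert (K * (pd z po + pd z' po) * pd z z' <= K * (2 * r) * pd z z').
  { apply Rmult_le_compat_r; auto; apply Rmult_le_compat_l; lra. }
  lra.
Qed.

Lemma strict_diff_near (S : pspace) (f : S -> R) f0 L (eps : R) :
  strict_diff S f f0 L -> 0 < eps -> near S (fun z => Rabs (f z - f0) < eps).
Proof.
  intros Hf He; destruct (strict_diff_lipschitz S f f0 L Hf) as [K [r [K0 [r0 H]]]].
  destruct Hf as [H0 _].
  exists (Rmin r (eps / (K + 1))); split.
  - apply Rmin_glb_lt; auto; apply Rdiv_lt_0_compat; lra.
  - intros z Hz; pose proof (Rmin_l r (eps / (K + 1))); pose proof (Rmin_r r (eps / (K + 1))).
    rewrite <- H0; eapply Rle_lt_trans; [apply H; [lra|rewrite pd_refl; auto]|].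
    pose proof (pd_ge0 S z po).
    assert (Hz' : pd z po < eps / (K + 1)) by lra.
    apply Rlt_div_r in Hz'; nra.
Qed.

Lemma strict_diff_const (S : pspace) (c : R) :
  strict_diff S (fun _ => c) c (fun _ => 0).
Proof.
  split; [auto|split].
  - exists 0; split; [lra|]; intros; rewrite Rminus_diag, Rabs_R0; lra.
  - exists 0, 1; repeat split; try lra; intros.
    rewrite !Rminus_diag, Rabs_R0; lra.
Qed.

Lemma strict_diff_id : strict_diff Rspace (fun x => x) 0 (fun x => x).
Proof.
  split; [auto|split].
  - exists 1; split; [lra|]; intros; simpl; lra.
  - exists 0, 1; repeat split; try lra; intros.
    rewrite Rminus_diag, Rabs_R0; lra.
Qed.

Lemma strict_diff_snd (S : pspace) : strict_diff (padd S) (fun p => snd p) 0 (fun p => snd p).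
Proof.
  split; [auto|split].
  - exists 1; split; [lra|]; intros; simpl; pose proof (pd_ge0 S (fst z) (fst z')); lra.
  - exists 0, 1; repeat split; try lra; intros.
    rewrite Rminus_diag, Rabs_R0; lra.
Qed.

Lemma strict_diff_fst (S : pspace) (f : S -> R) f0 L : strict_diff S f f0 L ->
  strict_diff (padd S) (fun p => f (fst p)) f0 (fun p => L (fst p)).
Proof.
  intros [H0 [[M [M0 HM]] [K [r [K0 [r0 H]]]]]]; split; [auto|split].
  - exists M; split; auto; intros [z x] [z' x']; simpl.
    eapply Rle_trans; [apply HM|]; apply Rmult_le_compat_l; auto.
    pose proof (Rabs_pos (x - x')); lra.
  - exists K, r; repeat split; auto; intros [z x] [z' x']; simpl; intros Hz Hz'.
    pose proof (Rabs_pos (x - x')); pose proof (Rabs_pos (x - 0)); pose proof (Rabs_pos (x' - 0)).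
    pose proof (pd_ge0 S z z'); pose proof (pd_ge0 S z po); pose proof (pd_ge0 S z' po).
    eapply Rle_trans; [apply H; lra|].
    apply Rmult_le_compat; try lra.
    + apply Rmult_le_pos; lra.
    + apply Rmult_le_compat_l; lra.
Qed.

Lemma strict_diff_plus (S : pspace) (f g : S -> R) f0 g0 L M :
  strict_diff S f f0 L -> strict_diff S g g0 M ->
  strict_diff S (fun z => f z + g z) (f0 + g0) (fun z => L z + M z).
Proof.
  intros [H0 [[A [A0 HA]] [K [r [K0 [r0 H]]]]]] [H0' [[A' [A0' HA']] [K' [r' [K0' [r0' H']]]]]].
  split; [congruence|split].
  - exists (A + A'); split; [lra|]; intros z z'; specialize (HA z z'); specialize (HA' z z').
    replace (L z + M z - (L z' + M z')) with ((L z - L z') + (M z - M z')) by ring.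
    eapply Rle_trans; [apply Rabs_triang|]; lra.
  - exists (K + K'), (Rmin r r'); repeat split; [lra|now apply Rmin_glb_lt|].
    intros z z' Hz Hz'; pose proof (Rmin_l r r'); pose proof (Rmin_r r r').
    specialize (H z z' ltac:(lra) ltac:(lra)); specialize (H' z z' ltac:(lra) ltac:(lra)).
    replace (f z + g z - (f z' + g z') - (L z + M z - (L z' + M z'))) with
      ((f z - f z' - (L z - L z')) + (g z - g z' - (M z - M z'))) by ring.
    eapply Rle_trans; [apply Rabs_triang|]; lra.
Qed.

Lemma strict_diff_mult (S : pspace) (f g : S -> R) f0 g0 L M :
  strict_diff S f f0 L -> strict_diff S g g0 M ->
  strict_diff S (fun z => f z * g z) (f0 * g0) (fun z => f0 * M z + g0 * L z).
Proof.
  intros Hf Hg.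
  destruct (strict_diff_lipschitz _ _ _ _ Hf) as [F [s [F0 [s0 HF]]]].
  destruct (strict_diff_lipschitz _ _ _ _ Hg) as [G [s' [G0 [s0' HG]]]].
  destruct Hf as [H0 [[A [A0 HA]] [K [r [K0 [r0 H]]]]]].
  destruct Hg as [H0' [[A' [A0' HA']] [K' [r' [K0' [r0' H']]]]]].
  pose proof (Rabs_pos f0); pose proof (Rabs_pos g0).
  split; [congruence|split].
  - exists (Rabs f0 * A' + Rabs g0 * A); split; [nra|]; intros z z'; specialize (HA z z'); specialize (HA' z z').
    replace (f0 * M z + g0 * L z - (f0 * M z' + g0 * L z')) with (f0 * (M z - M z') + g0 * (L z - L z')) by ring.
    eapply Rle_trans; [apply Rabs_triang|]; rewrite !Rabs_mult.
    pose proof (Rmult_le_compat_l (Rabs f0) _ _ H1 HA').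
    pose proof (Rmult_le_compat_l (Rabs g0) _ _ H2 HA). lra.
  - exists (Rabs f0 * K' + Rabs g0 * K + F * G), (Rmin (Rmin r r') (Rmin s s')).
    repeat split; [|repeat apply Rmin_glb_lt; auto|].
    { repeat apply Rplus_le_le_0_compat; apply Rmult_le_pos; auto. }
    intros z z' Hz Hz'.
    pose proof (Rmin_l (Rmin r r') (Rmin s s')); pose proof (Rmin_r (Rmin r r') (Rmin s s')).
    pose proof (Rmin_l r r'); pose proof (Rmin_r r r'); pose proof (Rmin_l s s'); pose proof (Rmin_r s s').
    specialize (H z z' ltac:(lra) ltac:(lra)); specialize (H' z z' ltac:(lra) ltac:(lra)).
    assert (Hfz : Rabs (f z - f0) <= F * pd z po).
    { rewrite <- H0; apply HF; [lra|rewrite pd_refl; auto]. }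
    assert (Hgz : Rabs (g z' - g0) <= G * pd z' po).
    { rewrite <- H0'; apply HG; [lra|rewrite pd_refl; auto]. }
    specialize (HF z z' ltac:(lra) ltac:(lra)); specialize (HG z z' ltac:(lra) ltac:(lra)).
    (* The error splits into the two linearisation errors, weighted by the base values, and two
       products of a deviation from a base value with an increment, both of second order. *)
    replace (f z * g z - f z' * g z' - (f0 * M z + g0 * L z - (f0 * M z' + g0 * L z'))) with
      (f0 * (g z - g z' - (M z - M z')) + g0 * (f z - f z' - (L z - L z'))
       + ((f z - f0) * (g z - g z') + (g z' - g0) * (f z - f z'))) by ring.
    eapply Rle_trans; [apply Rabs_triang|].
    eapply Rle_trans; [apply Rplus_le_compat; apply Rabs_triang|].
    rewrite !Rabs_mult.
    pose proof (pd_ge0 S z z'); pose proof (pd_ge0 S z po); pose proof (pd_ge0 S z' po).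
    pose proof (Rmult_le_compat_l (Rabs f0) _ _ H1 H').
    pose proof (Rmult_le_compat_l (Rabs g0) _ _ H2 H).
    pose proof (Rmult_le_compat _ _ _ _ (Rabs_pos _) (Rabs_pos _) Hfz HG).
    pose proof (Rmult_le_compat _ _ _ _ (Rabs_pos _) (Rabs_pos _) Hgz HF).
    lra.
Qed.

(** The same notion for the outer function of a composition, at a base value [s0] that need not be
    0. *)
Definition scalar_strict_diff (phi : R -> R) (s0 m : R) : Prop :=
  exists K rho, 0 <= K /\ 0 < rho /\ forall s s', Rabs (s - s0) < rho -> Rabs (s' - s0) < rho ->
    Rabs (phi s - phi s' - m * (s - s')) <= K * (Rabs (s - s0) + Rabs (s' - s0)) * Rabs (s - s').

Lemma strict_diff_comp (S : pspace) (f : S -> R) f0 L (phi : R -> R) (m : R) :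
  strict_diff S f f0 L -> scalar_strict_diff phi f0 m ->
  strict_diff S (fun z => phi (f z)) (phi f0) (fun z => m * L z).
Proof.
  intros Hf [Q [rho [Q0 [rho0 HQ]]]].
  destruct (strict_diff_near _ _ _ _ rho Hf rho0) as [t [t0 Ht]].
  destruct (strict_diff_lipschitz _ _ _ _ Hf) as [F [s [F0 [s0 HF]]]].
  destruct Hf as [H0 [[A [A0 HA]] [K [r [K0 [r0 H]]]]]].
  pose proof (Rabs_pos m) as Hm.
  split; [congruence|split].
  - exists (Rabs m * A); split; [nra|]; intros z z'; specialize (HA z z').
    rewrite <- Rmult_minus_distr_l, Rabs_mult, Rmult_assoc; apply Rmult_le_compat_l; auto.
  - exists (Q * F * F + Rabs m * K), (Rmin r (Rmin s t)).
    repeat split; [|repeat apply Rmin_glb_lt; auto|].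
    { repeat apply Rplus_le_le_0_compat; repeat apply Rmult_le_pos; auto. }
    intros z z' Hz Hz'.
    pose proof (Rmin_l r (Rmin s t)); pose proof (Rmin_r r (Rmin s t)).
    pose proof (Rmin_l s t); pose proof (Rmin_r s t).
    specialize (H z z' ltac:(lra) ltac:(lra)).
    assert (Hfz : Rabs (f z - f0) <= F * pd z po).
    { rewrite <- H0; apply HF; [lra|rewrite pd_refl; auto]. }
    assert (Hfz' : Rabs (f z' - f0) <= F * pd z' po).
    { rewrite <- H0; apply HF; [lra|rewrite pd_refl; auto]. }
    specialize (HF z z' ltac:(lra) ltac:(lra)).
    specialize (HQ (f z) (f z') ltac:(apply Ht; lra) ltac:(apply Ht; lra)).
    replace (phi (f z) - phi (f z') - (m * L z - m * L z')) with
      ((phi (f z) - phi (f z') - m * (f z - f z')) + m * (f z - f z' - (L z - L z'))) by ring.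
    eapply Rle_trans; [apply Rabs_triang|]; rewrite (Rabs_mult m).
    pose proof (Rmult_le_compat_l (Rabs m) _ _ Hm H).
    assert (Q * (Rabs (f z - f0) + Rabs (f z' - f0)) * Rabs (f z - f z') <=
            Q * (F * (pd z po + pd z' po)) * (F * pd z z')).
    { apply Rmult_le_compat; auto using Rabs_pos.
      - apply Rmult_le_pos; auto; apply Rplus_le_le_0_compat; apply Rabs_pos.
      - apply Rmult_le_compat_l; auto; lra. }
    lra.
Qed.

Lemma scalar_strict_diff_inv (s0 : R) : s0 <> 0 -> scalar_strict_diff Rinv s0 (- / s0 ^ 2).
Proof.
  intros H0; set (a := Rabs s0); assert (Ha : 0 < a) by now apply Rabs_pos_lt.
  assert (Hinv : forall s, Rabs (s - s0) < a / 2 -> s <> 0 /\ / Rabs s <= 2 / a).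
  { intros s Hs; assert (a / 2 <= Rabs s).
    { pose proof (Rabs_triang_inv s0 (s0 - s)).
      replace (s0 - (s0 - s)) with s in H by ring; rewrite Rabs_minus_sym in Hs.
      unfold a in *; lra. }
    split; [intros ->; rewrite Rabs_R0 in H; lra|].
    replace (2 / a) with (/ (a / 2)) by (field; lra); apply Rinv_le_contravar; lra. }
  exists (8 / a ^ 3), (a / 2); repeat split; [|lra|].
  { apply Rlt_le, Rdiv_lt_0_compat; [lra|apply pow_lt; auto]. }
  intros s s' Hs Hs'.
  destruct (Hinv s Hs) as [Hs0 Hs1]; destruct (Hinv s' Hs') as [Hs0' Hs1'].
  assert (Hs2 : / Rabs s0 <= 2 / a).
  { unfold a; apply Rmult_le_reg_l with (Rabs s0); auto.
    replace (Rabs s0 * (2 / Rabs s0)) with 2 by (field; apply Rgt_not_eq; auto).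
    rewrite Rinv_r; [lra|apply Rgt_not_eq; auto]. }
  (* The error is exactly s - s' times a combination of s - s0 and s' - s0. Each coefficient is a
     product of three reciprocals, all at most 2 / a, which gives the constant 8 / a^3. *)
  replace (/ s - / s' - - / s0 ^ 2 * (s - s')) with
    (((s - s0) * (/ s * (/ s0 * / s0)) + (s' - s0) * (/ s * (/ s' * / s0))) * (s - s')) by (field; auto).
  rewrite Rabs_mult; apply Rmult_le_compat_r; [apply Rabs_pos|].
  eapply Rle_trans; [apply Rabs_triang|]; rewrite !Rabs_mult, !Rabs_inv.
  assert (Hprod : forall x y, x <> 0 -> y <> 0 -> / Rabs x <= 2 / a -> / Rabs y <= 2 / a ->
    / Rabs x * (/ Rabs y * / Rabs s0) <= 8 / a ^ 3).
  { intros x y Hx Hy Hx' Hy'.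
    replace (8 / a ^ 3) with (2 / a * (2 / a * (2 / a))) by (field; lra).
    assert (forall w, w <> 0 -> 0 <= / Rabs w)
      by (intros; apply Rlt_le, Rinv_0_lt_compat, Rabs_pos_lt; auto).
    apply Rmult_le_compat; auto; [apply Rmult_le_pos; auto|]; apply Rmult_le_compat; auto. }
  pose proof (Rmult_le_compat_l _ _ _ (Rabs_pos (s - s0)) (Hprod s s0 Hs0 H0 Hs1 Hs2)).
  pose proof (Rmult_le_compat_l _ _ _ (Rabs_pos (s' - s0)) (Hprod s s' Hs0 Hs0' Hs1 Hs1')).
  lra.
Qed.

Lemma strict_diff_inv (S : pspace) (f : S -> R) f0 L : f0 <> 0 ->
  strict_diff S f f0 L -> strict_diff S (fun z => / f z) (/ f0) (fun z => - / f0 ^ 2 * L z).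
Proof. intros H0 Hf; apply (strict_diff_comp S f f0 L Rinv); auto using scalar_strict_diff_inv. Qed.

Lemma cos_lipschitz (x y : R) : Rabs (cos x - cos y) <= Rabs (x - y).
Proof.
  destruct (MVT_gen cos y x (fun t => - sin t)) as [t [_ Ht]].
  - intros; auto_derive; auto; ring.
  - intros; apply continuity_cos.
  - rewrite Ht, Rabs_mult, Rabs_Ropp; pose proof (Rabs_pos (x - y)).
    pose proof (SIN_bound t); assert (Rabs (sin t) <= 1) by (apply Rabs_le; lra); nra.
Qed.

Lemma sin_lipschitz (x y : R) : Rabs (sin x - sin y) <= Rabs (x - y).
Proof.
  destruct (MVT_gen sin y x cos) as [t [_ Ht]].
  - intros; auto_derive; auto; ring.
  - intros; apply continuity_sin.
  - rewrite Ht, Rabs_mult; pose proof (Rabs_pos (x - y)).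
    pose proof (COS_bound t); assert (Rabs (cos t) <= 1) by (apply Rabs_le; lra); nra.
Qed.

Lemma Rabs_between (x y t : R) : Rmin x y <= t <= Rmax x y -> Rabs t <= Rabs x + Rabs y.
Proof.
  unfold Rmin, Rmax; destruct (Rle_dec x y); unfold Rabs; repeat destruct Rcase_abs; lra.
Qed.

Lemma scalar_strict_diff_cos : scalar_strict_diff cos 0 0.
Proof.
  exists 1, 1; repeat split; try lra; intros s s' _ _; rewrite !Rminus_0_r, Rmult_0_l, Rminus_0_r, Rmult_1_l.
  destruct (MVT_gen cos s' s (fun t => - sin t)) as [t [Ht1 Ht]].
  - intros; auto_derive; auto; ring.
  - intros; apply continuity_cos.
  - rewrite Ht, Rabs_mult, Rabs_Ropp; apply Rmult_le_compat_r; [apply Rabs_pos|].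
    apply Rabs_between in Ht1; pose proof (sin_lipschitz t 0).
    rewrite sin_0, !Rminus_0_r in H; lra.
Qed.

Lemma scalar_strict_diff_sin : scalar_strict_diff sin 0 1.
Proof.
  exists 1, 1; repeat split; try lra; intros s s' _ _; rewrite !Rminus_0_r, !Rmult_1_l.
  destruct (MVT_gen (fun t => sin t - t) s' s (fun t => cos t - 1)) as [t [Ht1 Ht]].
  - intros; auto_derive; auto; ring.
  - intros; apply continuity_pt_minus; [apply continuity_sin|apply continuity_pt_id].
  - replace (sin s - sin s' - (s - s')) with (sin s - s - (sin s' - s')) by ring.
    rewrite Ht, Rabs_mult; apply Rmult_le_compat_r; [apply Rabs_pos|].
    apply Rabs_between in Ht1; pose proof (cos_lipschitz t 0).
    rewrite cos_0, !Rminus_0_r in H; lra.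
Qed.

(** The chain rule along the graph of [xi]. If [xi] is F-Lipschitz, passing to the graph stretches
    distances by at most 1 + F, which accounts for the factor (1 + F)^2 in the remainder. *)
Lemma strict_diff_graph (S : pspace) (f : S * R -> R) f0 (l : S -> R) (m : R) (xi : S -> R) (L : S -> R) :
  strict_diff (padd S) f f0 (fun p => l (fst p) + m * snd p) -> strict_diff S xi 0 L ->
  strict_diff S (fun z => f (z, xi z)) f0 (fun z => l z + m * L z).
Proof.
  intros Hf Hx.
  destruct (strict_diff_lipschitz _ _ _ _ Hx) as [F [s [F0 [s0 HF]]]].
  destruct Hf as [H0 [[A [A0 HA]] [K [r [K0 [r0 H]]]]]].
  destruct Hx as [X0 [[B [B0 HB]] [K' [r' [K0' [r0' H']]]]]].
  pose proof (Rabs_pos m) as Hm.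
  split; [rewrite X0; exact H0|split].
  - exists (A + Rabs m * B); split; [nra|]; intros z z'; specialize (HA (z, 0) (z', 0)); specialize (HB z z').
    simpl in HA; rewrite Rminus_diag, Rabs_R0, Rplus_0_r in HA.
    replace (l z + m * L z - (l z' + m * L z')) with
     ((l z + m * 0 - (l z' + m * 0)) + m * (L z - L z')) by ring.
    eapply Rle_trans; [apply Rabs_triang|]; rewrite (Rabs_mult m).
    pose proof (Rmult_le_compat_l _ _ _ Hm HB); lra.
  - exists (K * (1 + F) * (1 + F) + Rabs m * K'), (Rmin (r / (1 + F)) (Rmin s r')).
    assert (0 < r / (1 + F)) by (apply Rdiv_lt_0_compat; lra).
    repeat split; [|repeat apply Rmin_glb_lt; auto|].
    { repeat apply Rplus_le_le_0_compat; repeat apply Rmult_le_pos; auto; lra. }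
    intros z z' Hz Hz'.
    pose proof (Rmin_l (r / (1 + F)) (Rmin s r')); pose proof (Rmin_r (r / (1 + F)) (Rmin s r')).
    pose proof (Rmin_l s r'); pose proof (Rmin_r s r').
    assert (Hball : forall w : S, pd w po < Rmin (r / (1 + F)) (Rmin s r') ->
      Rabs (xi w) <= F * pd w po /\ pd w po + Rabs (xi w - 0) < r).
    { intros w Hw; assert (Rabs (xi w) <= F * pd w po).
      { replace (xi w) with (xi w - xi po) by (rewrite X0; ring).
        apply HF; [lra|rewrite pd_refl; lra]. }
      split; auto; rewrite Rminus_0_r.
      assert (Hw' : pd w po < r / (1 + F)) by lra.
      apply Rlt_div_r in Hw'; lra. }
    destruct (Hball z Hz) as [Ha Hb]; destruct (Hball z' Hz') as [Ha' Hb'].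
    specialize (H (z, xi z) (z', xi z') Hb Hb'); simpl in H; rewrite !Rminus_0_r in H.
    specialize (H' z z' ltac:(lra) ltac:(lra)).
    specialize (HF z z' ltac:(lra) ltac:(lra)).
    replace (f (z, xi z) - f (z', xi z') - (l z + m * L z - (l z' + m * L z'))) with
     ((f (z, xi z) - f (z', xi z') - (l z + m * xi z - (l z' + m * xi z')))
       + m * (xi z - xi z' - (L z - L z'))) by ring.
    eapply Rle_trans; [apply Rabs_triang|]; rewrite (Rabs_mult m).
    pose proof (Rmult_le_compat_l _ _ _ Hm H').
    pose proof (pd_ge0 S z z'); pose proof (pd_ge0 S z po); pose proof (pd_ge0 S z' po).
    pose proof (Rabs_pos (xi z)); pose proof (Rabs_pos (xi z')); pose proof (Rabs_pos (xi z - xi z')).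
    assert (K * (pd z po + Rabs (xi z) + (pd z' po + Rabs (xi z'))) * (pd z z' + Rabs (xi z - xi z'))
      <= K * ((1 + F) * (pd z po + pd z' po)) * ((1 + F) * pd z z')).
    { apply Rmult_le_compat.
      - apply Rmult_le_pos; lra.
      - lra.
      - apply Rmult_le_compat_l; lra.
      - lra. }
    lra.
Qed.

Lemma lipschitz_continuity_pt (phi : R -> R) (F x e : R) : 0 <= F -> 0 < e ->
  (forall y, Rabs (y - x) < e -> Rabs (phi y - phi x) <= F * Rabs (y - x)) ->
  continuity_pt phi x.
Proof.
  intros F0 e0 H eps Heps.
  exists (Rmin e (eps / (F + 1))); split.
  - apply Rmin_glb_lt; auto; apply Rdiv_lt_0_compat; lra.
  - intros y [_ Hy]; simpl in *; unfold Rdist in *.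
    pose proof (Rmin_l e (eps / (F + 1))); pose proof (Rmin_r e (eps / (F + 1))).
    eapply Rle_lt_trans; [apply H; lra|].
    assert (Hy' : Rabs (y - x) < eps / (F + 1)) by lra.
    apply Rlt_div_r in Hy'; [|lra]; pose proof (Rabs_pos (y - x)); nra.
Qed.

(** On a small interval f (z, .) differs from the identity by a 1/2-Lipschitz function, so it
    increases with slope at least 1/2. The intermediate value theorem gives a zero, the slope makes
    it Lipschitz in z, and strict differentiability of f between two zeros yields the differential
    of [xi]. *)
Lemma strict_diff_implicit1 (S : pspace) (f : S * R -> R) (l : S -> R) :
  strict_diff (padd S) f 0 (fun p => l (fst p) + snd p) ->
  exists xi : S -> R, strict_diff S xi 0 (fun z => - l z) /\ near S (fun z => f (z, xi z) = 0).
Proof.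
  intros Hf.
  destruct (strict_diff_lipschitz _ _ _ _ Hf) as [F [r2 [F0 [r20 HF]]]].
  destruct Hf as [H0 [[A [A0 HA]] [K [r [K0 [r0 H]]]]]].
  simpl in HF, HA, H, H0.
  (* The first bound gives 12 K s <= 1, so that the remainder factor K (6 s) is at most 1/2; the
     quarters of [r] and [r2] keep all points used below inside both balls. *)
  set (s := Rmin (/ (12 * (K + 1))) (Rmin (r / 4) (r2 / 4))).
  assert (s0 : 0 < s).
  { repeat apply Rmin_glb_lt; try lra; apply Rinv_0_lt_compat; lra. }
  assert (s1 : s <= r / 4 /\ s <= r2 / 4 /\ 12 * K * s <= 1).
  { pose proof (Rmin_l (/ (12 * (K + 1))) (Rmin (r / 4) (r2 / 4))).
    pose proof (Rmin_r (/ (12 * (K + 1))) (Rmin (r / 4) (r2 / 4))).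
    pose proof (Rmin_l (r / 4) (r2 / 4)); pose proof (Rmin_r (r / 4) (r2 / 4)).
    fold s in H1, H2; repeat split; try lra.
    apply Rmult_le_compat_r with (r := 12 * (K + 1)) in H1; [|lra].
    rewrite Rinv_l in H1; lra. }
  destruct s1 as [s1 [s2 s3]].
  (* For z within t of the base point, |f (z, 0)| <= F t < s / 2, less than a slope of at least 1/2
     gains over the length s. Hence f (z, .) changes sign on [-s, s]. *)
  set (t := s / (2 * (F + 1))).
  assert (t0 : 0 < t) by (apply Rdiv_lt_0_compat; lra).
  assert (tF : 2 * (F + 1) * t = s) by (unfold t; field; lra).
  assert (ts : t <= s) by nra.
  assert (slope : forall z x x', pd z po < t -> Rabs x <= s -> Rabs x' <= s ->
    Rabs (f (z, x) - f (z, x') - (x - x')) <= / 2 * Rabs (x - x')).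
  { intros z x x' Hz Hx Hx'.
    specialize (H (z, x) (z, x')); simpl in H; rewrite pd_refl, !Rminus_0_r in H.
    pose proof (pd_ge0 S z po).
    specialize (H ltac:(lra) ltac:(lra)).
    replace (f (z, x) - f (z, x') - (x - x')) with
      (f (z, x) - f (z, x') - (l z + x - (l z + x'))) by ring.
    eapply Rle_trans; [apply H|]; rewrite Rplus_0_l.
    apply Rmult_le_compat_r; [apply Rabs_pos|].
    apply Rle_trans with (K * (6 * s)); [apply Rmult_le_compat_l; lra|lra]. }
  (* The bound on z sits inside the existential, with default witness 0, so that choice yields a
     function on all of [S]. *)
  assert (Hex : forall z, exists x, pd z po < t -> Rabs x <= s /\ f (z, x) = 0).
  { intros z; destruct (Rlt_dec (pd z po) t) as [Hz|Hz]; [|exists 0; intros; contradiction].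
    pose proof (pd_ge0 S z po) as Hz0.
    assert (Hf0 : Rabs (f (z, 0)) <= F * pd z po).
    { specialize (HF (z, 0) (po, 0)); simpl in HF.
      rewrite pd_refl, Rminus_diag, Rabs_R0, Rplus_0_l, Rplus_0_r, H0, Rminus_0_r in HF.
      apply HF; lra. }
    assert (Hss : Rabs s = s) by (apply Rabs_right; lra).
    assert (Hsm : Rabs (- s) = s) by (rewrite Rabs_Ropp; auto).
    assert (Hp : 0 < f (z, s)).
    { pose proof (slope z s 0 Hz ltac:(lra) ltac:(rewrite Rabs_R0; lra)) as Hs.
      rewrite Rminus_0_r, Hss in Hs; apply Rabs_le_between in Hs; apply Rabs_le_between in Hf0; nra. }
    assert (Hn : f (z, - s) < 0).
    { pose proof (slope z (- s) 0 Hz ltac:(lra) ltac:(rewrite Rabs_R0; lra)) as Hs.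
      rewrite Rminus_0_r, Hsm in Hs; apply Rabs_le_between in Hs; apply Rabs_le_between in Hf0; nra. }
    destruct (IVT_interv (fun x => f (z, x)) (- s) s) as [x [Hx1 Hx2]]; auto; [|lra|].
    - intros x Hx; apply (lipschitz_continuity_pt _ F x s); auto.
      intros y Hy; specialize (HF (z, y) (z, x)); simpl in HF.
      rewrite pd_refl, Rplus_0_l, !Rminus_0_r in HF.
      assert (Rabs x <= s) by (apply Rabs_le; lra).
      assert (Rabs y <= 2 * s).
      { replace y with ((y - x) + x) by ring; eapply Rle_trans; [apply Rabs_triang|]; lra. }
      apply HF; lra.
    - exists x; intros _; split; auto; apply Rabs_le; lra. }
  set (xi := fun z => proj1_sig (constructive_indefinite_description _ (Hex z))).
  assert (Hxi : forall z, pd z po < t -> Rabs (xi z) <= s /\ f (z, xi z) = 0).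
  { intros z; exact (proj2_sig (constructive_indefinite_description _ (Hex z))). }
  (* The slope gives |xi z - xi z'| <= 2 |f (z, xi z')|, and f (z', xi z') = 0 turns the right side
     into an increment of f in z alone. *)
  assert (Hlip : forall z z', pd z po < t -> pd z' po < t ->
    Rabs (xi z - xi z') <= 2 * F * pd z z').
  { intros z z' Hz Hz'; destruct (Hxi z Hz) as [Ha Hb]; destruct (Hxi z' Hz') as [Ha' Hb'].
    pose proof (slope z (xi z) (xi z') Hz Ha Ha') as Hs; rewrite Hb in Hs.
    specialize (HF (z, xi z') (z', xi z')); simpl in HF.
    rewrite Rminus_diag, Rabs_R0, Rplus_0_r, !Rminus_0_r, Hb', Rminus_0_r in HF.
    specialize (HF ltac:(lra) ltac:(lra)).
    replace (0 - f (z, xi z') - (xi z - xi z')) with (- (f (z, xi z') + (xi z - xi z'))) in Hs by ring.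
    rewrite Rabs_Ropp in Hs.
    pose proof (Rabs_triang_inv (xi z - xi z') (- f (z, xi z'))) as Ht.
    rewrite Rabs_Ropp in Ht.
    replace (xi z - xi z' - - f (z, xi z')) with (f (z, xi z') + (xi z - xi z')) in Ht by ring.
    lra. }
  assert (Hpo : pd (po : S) po < t) by (rewrite pd_refl; auto).
  assert (Hxi0 : xi po = 0).
  { destruct (Hxi po Hpo) as [Ha Hb].
    pose proof (slope po (xi po) 0 Hpo Ha ltac:(rewrite Rabs_R0; lra)) as Hs.
    rewrite Hb, H0, !Rminus_0_r, Rminus_0_l, Rabs_Ropp in Hs.
    apply NNPP; intros Hne; apply Rabs_pos_lt in Hne; lra. }
  exists xi; split; [split; [auto|split]|].
  - exists A; split; auto; intros z z'; specialize (HA (z, 0) (z', 0)); simpl in HA.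
    rewrite Rminus_diag, Rabs_R0, !Rplus_0_r in HA.
    replace (- l z - - l z') with (- (l z - l z')) by ring; rewrite Rabs_Ropp; auto.
  - exists (K * (1 + 2 * F) * (1 + 2 * F)), t; repeat split; auto.
    { repeat apply Rmult_le_pos; lra. }
    intros z z' Hz Hz'; destruct (Hxi z Hz) as [Ha Hb]; destruct (Hxi z' Hz') as [Ha' Hb'].
    pose proof (Hlip z z' Hz Hz') as Hl.
    pose proof (Hlip z po Hz Hpo) as Hlz; pose proof (Hlip z' po Hz' Hpo) as Hlz'.
    rewrite Hxi0, Rminus_0_r in Hlz, Hlz'.
    specialize (H (z, xi z) (z', xi z')); simpl in H; rewrite Hb, Hb', !Rminus_0_r in H.
    specialize (H ltac:(lra) ltac:(lra)).
    replace (xi z - xi z' - (- l z - - l z')) with (- (0 - (l z + xi z - (l z' + xi z')))) by ring.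
    rewrite Rabs_Ropp; eapply Rle_trans; [apply H|].
    pose proof (pd_ge0 S z z'); pose proof (pd_ge0 S z po); pose proof (pd_ge0 S z' po).
    pose proof (Rabs_pos (xi z)); pose proof (Rabs_pos (xi z')); pose proof (Rabs_pos (xi z - xi z')).
    apply Rle_trans with (K * ((1 + 2 * F) * (pd z po + pd z' po)) * ((1 + 2 * F) * pd z z')).
    + apply Rmult_le_compat.
      * apply Rmult_le_pos; lra.
      * lra.
      * apply Rmult_le_compat_l; lra.
      * lra.
    + apply Req_le; ring.
  - exists t; split; auto; intros z Hz; apply Hxi; auto.
Qed.

Lemma strict_diff_implicit (S : pspace) (f : S * R -> R) (l : S -> R) (m : R) : m <> 0 ->
  strict_diff (padd S) f 0 (fun p => l (fst p) + m * snd p) ->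
  exists xi : S -> R, strict_diff S xi 0 (fun z => - (l z / m)) /\ near S (fun z => f (z, xi z) = 0).
Proof.
  intros Hm Hf.
  destruct (strict_diff_implicit1 S (fun p => / m * f p) (fun z => l z / m)) as [xi [H1 H2]].
  - eapply strict_diff_ext; [| | |exact (strict_diff_mult _ _ _ _ _ _ _ (strict_diff_const _ (/ m)) Hf)];
      intros; simpl; auto; field; auto.
  - exists xi; split; auto; revert H2; apply near_imp; intros z Hz.
    apply Rmult_integral in Hz; destruct Hz as [Hz|]; auto.
    now apply Rinv_neq_0_compat in Hz.
Qed.

Lemma near_graph (S : pspace) (xi : S -> R) (L : S -> R) (P : S * R -> Prop) :
  strict_diff S xi 0 L -> near (padd S) P -> near S (fun z => P (z, xi z)).
Proof.
  intros Hx [r [r0 Hr]].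
  destruct (strict_diff_near _ _ _ _ (r / 2) Hx ltac:(lra)) as [s [s0 Hs]].
  exists (Rmin s (r / 2)); split; [apply Rmin_glb_lt; lra|].
  intros z Hz; pose proof (Rmin_l s (r / 2)); pose proof (Rmin_r s (r / 2)).
  apply Hr; simpl; specialize (Hs z ltac:(lra)); lra.
Qed.

(** The differential in the three unknowns is m times the identity. Solving for the last unknown and
    substituting it leaves the linear parts of the other equations unchanged, so the unknowns can be
    eliminated one after the other. *)
Lemma strict_diff_implicit3 (S : pspace) (f1 f2 f3 : S * R * R * R -> R) (l1 l2 l3 : S -> R) (m : R) :
  m <> 0 ->
  strict_diff (padd (padd (padd S))) f1 0 (fun p => l1 (fst (fst (fst p))) + m * snd (fst (fst p))) ->
  strict_diff (padd (padd (padd S))) f2 0 (fun p => l2 (fst (fst (fst p))) + m * snd (fst p)) ->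
  strict_diff (padd (padd (padd S))) f3 0 (fun p => l3 (fst (fst (fst p))) + m * snd p) ->
  exists x1 x2 x3 : S -> R,
    strict_diff S x1 0 (fun z => - (l1 z / m)) /\
    strict_diff S x2 0 (fun z => - (l2 z / m)) /\
    strict_diff S x3 0 (fun z => - (l3 z / m)) /\
    near S (fun z => f1 (z, x1 z, x2 z, x3 z) = 0 /\ f2 (z, x1 z, x2 z, x3 z) = 0 /\
                     f3 (z, x1 z, x2 z, x3 z) = 0).
Proof.
  intros Hm H1 H2 H3.
  destruct (strict_diff_implicit (padd (padd S)) f3 (fun p => l3 (fst (fst p))) m Hm H3) as [y3 [D3 N3]].
  assert (D2 := strict_diff_graph (padd (padd S)) f2 0
    (fun p => l2 (fst (fst p)) + m * snd p) 0 y3 _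
    ltac:(eapply strict_diff_ext; [| | |exact H2]; intros; simpl; ring) D3).
  assert (D1 := strict_diff_graph (padd (padd S)) f1 0
    (fun p => l1 (fst (fst p)) + m * snd (fst p)) 0 y3 _
    ltac:(eapply strict_diff_ext; [| | |exact H1]; intros; simpl; ring) D3).
  destruct (strict_diff_implicit (padd S) (fun p => f2 (p, y3 p)) (fun p => l2 (fst p)) m Hm) as [y2 [E2 N2]].
  { eapply strict_diff_ext; [| | |exact D2]; intros; simpl; ring. }
  assert (E1 := strict_diff_graph (padd S) (fun p => f1 (p, y3 p)) 0
    (fun p => l1 (fst p) + m * snd p) 0 y2 _
    ltac:(eapply strict_diff_ext; [| | |exact D1]; intros; simpl; ring) E2).
  assert (E3 := strict_diff_graph (padd S) y3 0
    (fun p => - (l3 (fst p) / m)) 0 y2 _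
    ltac:(eapply strict_diff_ext; [| | |exact D3]; intros; simpl; ring) E2).
  destruct (strict_diff_implicit S (fun p => f1 (p, y2 p, y3 (p, y2 p))) l1 m Hm) as [y1 [F1 N1]].
  { eapply strict_diff_ext; [| | |exact E1]; intros; simpl; ring. }
  assert (F2 := strict_diff_graph S y2 0 (fun z => - (l2 z / m)) 0 y1 _
    ltac:(eapply strict_diff_ext; [| | |exact E2]; intros; simpl; ring) F1).
  assert (F3 := strict_diff_graph S (fun p => y3 (p, y2 p)) 0 (fun z => - (l3 z / m)) 0 y1 _
    ltac:(eapply strict_diff_ext; [| | |exact E3]; intros; simpl; ring) F1).
  exists y1, (fun z => y2 (z, y1 z)), (fun z => y3 (z, y1 z, y2 (z, y1 z))).
  split; [auto|split; [|split]].
  - eapply strict_diff_ext; [| | |exact F2]; intros; simpl; ring.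
  - eapply strict_diff_ext; [| | |exact F3]; intros; simpl; ring.
  - apply near_and; auto; apply near_and.
    + exact (near_graph S y1 _ _ F1 N2).
    + exact (near_graph S y1 _ _ F1 (near_graph _ y2 _ _ E2 N3)).
Qed.

(** * The Riccati recursion *)

(* A pair (g, h) stands for the real-linear map v |-> g v + h conj(v). *)
Definition weyl := (R * C)%type.

(** Minus the determinant of this real-linear map of the plane. *)
Definition wden (w : weyl) : R := fst (snd w) ^ 2 + snd (snd w) ^ 2 - fst w ^ 2.

(** A Schur complement that eliminates the next site: it stands for v |-> e v + a conj(v) + be
    conj(v'), where v' solves w v' = - be conj(v). [wnext] is this v'. *)
Definition wstep (e : R) (a be : C) (w : weyl) : weyl :=
  (e + (fst be ^ 2 + snd be ^ 2) * (fst w / wden w),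
   (a - be * be * Cconj (snd w) / RtoC (wden w))%C).

Definition wnext (be : C) (w : weyl) (v : C) : C :=
  Cconj ((Cconj be * RtoC (fst w) * v - be * Cconj (snd w) * Cconj v) / RtoC (wden w))%C.

Definition wapply (w : weyl) (v : C) : C := (RtoC (fst w) * v + snd w * Cconj v)%C.

Lemma wapply_next (be : C) (w : weyl) (v : C) : wden w <> 0 ->
  wapply w (wnext be w v) = (- be * Cconj v)%C.
Proof.
  destruct w as [g [x y]], be as [p q], v as [s t]; unfold wapply, wnext, wden; simpl; intros HD.
  unfold Cconj, Cdiv, Cinv, RtoC, Cmult, Cminus, Cplus, Copp; simpl.
  apply injective_projections; simpl; field; lra.
Qed.

Lemma wapply_step (e : R) (a be : C) (w : weyl) (v : C) : wden w <> 0 ->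
  wapply (wstep e a be w) v = (RtoC e * v + a * Cconj v + be * Cconj (wnext be w v))%C.
Proof.
  destruct w as [g [x y]], be as [p q], v as [s t], a as [a1 a2].
  unfold wapply, wnext, wstep, wden; simpl; intros HD.
  unfold Cconj, Cdiv, Cinv, RtoC, Cmult, Cminus, Cplus, Copp; simpl.
  apply injective_projections; simpl; field; lra.
Qed.

(** At the base point the pair is (0, h0) with h0 real. The half-lines have h0 nonzero; the pair
    matched at the interface has h0 = 0. *)
Definition weyl_diff (S : pspace) (w : S -> weyl) (h0 : R) (Lg Lx Ly : S -> R) : Prop :=
  strict_diff S (fun z => fst (w z)) 0 Lg /\
  strict_diff S (fun z => fst (snd (w z))) h0 Lx /\
  strict_diff S (fun z => snd (snd (w z))) 0 Ly.

Lemma weyl_diff_ext (S : pspace) (w : S -> weyl) h0 h0' (Lg Lx Ly Lg' Lx' Ly' : S -> R) :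
  h0 = h0' -> (forall z, Lg z = Lg' z) -> (forall z, Lx z = Lx' z) -> (forall z, Ly z = Ly' z) ->
  weyl_diff S w h0 Lg Lx Ly -> weyl_diff S w h0' Lg' Lx' Ly'.
Proof.
  intros <- Hg Hx Hy [H1 [H2 H3]]; split; [|split];
    eapply strict_diff_ext; try eassumption; auto.
Qed.

(** At g = 0 the recursion for h is h |-> a - be^2 / h up to second order in g, whose derivative in
    h at H is B^2 / H^2; the g part has the same factor. Since be is real at the base point, its
    phase enters only through be^2, giving -2 B Lb / H in the imaginary part. *)
Lemma weyl_diff_step (S : pspace) (e : S -> R) (a be : S -> C) (w : S -> weyl)
    (a0 B H : R) (Le La Li Lb Lg Lx Ly : S -> R) : H <> 0 ->
  strict_diff S e 0 Le ->
  strict_diff S (fun z => fst (a z)) a0 La -> strict_diff S (fun z => snd (a z)) 0 Li ->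
  strict_diff S (fun z => fst (be z)) B (fun _ => 0) -> strict_diff S (fun z => snd (be z)) 0 Lb ->
  weyl_diff S w H Lg Lx Ly ->
  weyl_diff S (fun z => wstep (e z) (a z) (be z) (w z)) (a0 - B ^ 2 / H)
    (fun z => Le z + B ^ 2 / H ^ 2 * Lg z) (fun z => La z + B ^ 2 / H ^ 2 * Lx z)
    (fun z => Li z - 2 * B * Lb z / H + B ^ 2 / H ^ 2 * Ly z).
Proof.
  intros HH He Ha Hi Hb Hbi [Hg [Hx Hy]].
  assert (HD : strict_diff S (fun z => wden (w z)) (H ^ 2) (fun z => 2 * H * Lx z)).
  { eapply strict_diff_ext; [| | |
      exact (strict_diff_plus _ _ _ _ _ _ _ (strict_diff_mult _ _ _ _ _ _ _ Hx Hx)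
       (strict_diff_plus _ _ _ _ _ _ _ (strict_diff_mult _ _ _ _ _ _ _ Hy Hy)
         (strict_diff_mult _ _ _ _ _ _ _ (strict_diff_const _ (-1)) (strict_diff_mult _ _ _ _ _ _ _ Hg Hg))))];
      unfold wden; intros; simpl; ring. }
  assert (HDi := strict_diff_inv _ _ _ _ (pow_nonzero _ 2 HH) HD).
  assert (Hbb := strict_diff_mult _ _ _ _ _ _ _ Hb Hb).
  assert (Hbibi := strict_diff_mult _ _ _ _ _ _ _ Hbi Hbi).
  assert (Hbbi := strict_diff_mult _ _ _ _ _ _ _ Hb Hbi).
  assert (m1 := strict_diff_const S (-1)).
  assert (Hre := strict_diff_plus _ _ _ _ _ _ _ Hbb (strict_diff_mult _ _ _ _ _ _ _ m1 Hbibi)).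
  assert (Him := strict_diff_mult _ _ _ _ _ _ _ (strict_diff_const S 2) Hbbi).
  assert (HxD := strict_diff_mult _ _ _ _ _ _ _ Hx HDi).
  assert (HyD := strict_diff_mult _ _ _ _ _ _ _ Hy HDi).
  assert (HgD := strict_diff_mult _ _ _ _ _ _ _ Hg HDi).
  split; [|split].
  - eapply strict_diff_ext; [| | |
      exact (strict_diff_plus _ _ _ _ _ _ _ He (strict_diff_mult _ _ _ _ _ _ _
        (strict_diff_plus _ _ _ _ _ _ _ Hbb Hbibi) HgD))]; intros; simpl;
      unfold Rdiv; try ring; field; auto.
  - eapply strict_diff_ext; [| | |
      exact (strict_diff_plus _ _ _ _ _ _ _ Ha (strict_diff_mult _ _ _ _ _ _ _ m1
         (strict_diff_plus _ _ _ _ _ _ _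
        (strict_diff_mult _ _ _ _ _ _ _ Hre HxD) (strict_diff_mult _ _ _ _ _ _ _ Him HyD))))]; intros.
    (* [strict_diff_ext] asks for equality at every point, including those where [wden] is zero;
       there the quotients are 0 on both sides. *)
    + cbv beta; simpl; unfold Rdiv, Rminus. destruct (Req_dec (wden (w z)) 0) as [E|E].
      * rewrite E; rewrite !Rinv_0; ring.
      * simpl; field; auto.
    + simpl; field; auto.
    + simpl; field; auto.
  - eapply strict_diff_ext; [| | |
      exact (strict_diff_plus _ _ _ _ _ _ _ Hi (strict_diff_mult _ _ _ _ _ _ _ m1
         (strict_diff_plus _ _ _ _ _ _ _
        (strict_diff_mult _ _ _ _ _ _ _ Him HxD)
         (strict_diff_mult _ _ _ _ _ _ _ m1 (strict_diff_mult _ _ _ _ _ _ _ Hre HyD)))))]; intros.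
    + cbv beta; simpl; unfold Rdiv, Rminus. destruct (Req_dec (wden (w z)) 0) as [E|E].
      * rewrite E; rewrite !Rinv_0; ring.
      * simpl; field; auto.
    + simpl; field; auto.
    + simpl; field; auto.
Qed.

(** * The recursion over one cell *)

Definition Ek : pspace := padd Rspace.

(** Site 3 sees the next cell through the bond d e^(-ik/2) left by the gauge change; the intracell
    bond d e^(ik) becomes the coefficient of conj(v) at site 2, while at sites 1 and 3 this
    coefficient is b. *)
Definition site3 (b d E k : R) (w : weyl) : weyl := wstep E (RtoC b) (RtoC d * expi (- k / 2))%C w.
Definition site2 (b d E k : R) (w : weyl) : weyl := wstep E (RtoC d * expi k)%C (RtoC b) w.
Definition site1 (b E : R) (w : weyl) : weyl := wstep E (RtoC b) (RtoC b) w.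

Lemma strict_diff_scaled_cos (S : pspace) (f : S -> R) L (d : R) : strict_diff S f 0 L ->
  strict_diff S (fun z => fst (RtoC d * expi (f z))%C) d (fun _ => 0).
Proof.
  intros Hf; eapply strict_diff_ext; [| | |exact (strict_diff_mult _ _ _ _ _ _ _ (strict_diff_const S d)
    (strict_diff_comp _ _ _ _ _ _ Hf scalar_strict_diff_cos))]; intros; simpl;
   rewrite ?cos_0; ring.
Qed.

Lemma strict_diff_scaled_sin (S : pspace) (f : S -> R) L (d : R) : strict_diff S f 0 L ->
  strict_diff S (fun z => snd (RtoC d * expi (f z))%C) 0 (fun z => d * L z).
Proof.
  intros Hf; eapply strict_diff_ext; [| | |exact (strict_diff_mult _ _ _ _ _ _ _ (strict_diff_const S d)
    (strict_diff_comp _ _ _ _ _ _ Hf scalar_strict_diff_sin))]; intros; simpl;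
   rewrite ?sin_0; ring.
Qed.

Lemma strict_diff_neg_half (S : pspace) (f : S -> R) L : strict_diff S f 0 L ->
  strict_diff S (fun z => - f z / 2) 0 (fun z => - L z / 2).
Proof.
  intros Hf; eapply strict_diff_ext; [| | |exact (strict_diff_mult _ _ _ _ _ _ _ (strict_diff_const S (- / 2)) Hf)];
   intros; simpl; field.
Qed.

Section Cell.
Variables (S : pspace) (e k : S -> R) (Le Lk : S -> R) (w : S -> weyl) (Lg Lx Ly : S -> R) (b d H : R).
Hypotheses (HH : H <> 0) (He : strict_diff S e 0 Le) (Hk : strict_diff S k 0 Lk)
  (Hw : weyl_diff S w H Lg Lx Ly).

Lemma weyl_diff_site3 : weyl_diff S (fun z => site3 b d (e z) (k z) (w z)) (b - d ^ 2 / H)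
  (fun z => Le z + d ^ 2 / H ^ 2 * Lg z) (fun z => d ^ 2 / H ^ 2 * Lx z)
  (fun z => d ^ 2 / H * Lk z + d ^ 2 / H ^ 2 * Ly z).
Proof.
  eapply weyl_diff_ext; [| | | |
    apply (weyl_diff_step S e (fun _ => RtoC b) (fun z => (RtoC d * expi (- k z / 2))%C) w b d H
      Le (fun _ => 0) (fun _ => 0) (fun z => d * (- Lk z / 2)) Lg Lx Ly); auto].
  1-4: intros; simpl; field; auto.
  - apply strict_diff_const.
  - apply strict_diff_const.
  - eapply strict_diff_scaled_cos, strict_diff_neg_half; eauto.
  - apply strict_diff_scaled_sin, strict_diff_neg_half; auto.
Qed.

Lemma weyl_diff_site2 : weyl_diff S (fun z => site2 b d (e z) (k z) (w z)) (d - b ^ 2 / H)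
  (fun z => Le z + b ^ 2 / H ^ 2 * Lg z) (fun z => b ^ 2 / H ^ 2 * Lx z)
  (fun z => d * Lk z + b ^ 2 / H ^ 2 * Ly z).
Proof.
  eapply weyl_diff_ext; [| | | |
    apply (weyl_diff_step S e (fun z => (RtoC d * expi (k z))%C) (fun _ => RtoC b) w d b H
      Le (fun _ => 0) (fun z => d * Lk z) (fun _ => 0) Lg Lx Ly); auto].
  1-4: intros; simpl; field; auto.
  - eapply strict_diff_scaled_cos; eauto.
  - apply strict_diff_scaled_sin; auto.
  - apply strict_diff_const.
  - apply strict_diff_const.
Qed.

Lemma weyl_diff_site1 : weyl_diff S (fun z => site1 b (e z) (w z)) (b - b ^ 2 / H)
  (fun z => Le z + b ^ 2 / H ^ 2 * Lg z) (fun z => b ^ 2 / H ^ 2 * Lx z)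
  (fun z => b ^ 2 / H ^ 2 * Ly z).
Proof.
  eapply weyl_diff_ext; [| | | |
    apply (weyl_diff_step S e (fun _ => RtoC b) (fun _ => RtoC b) w b b H
      Le (fun _ => 0) (fun z => 0) (fun _ => 0) Lg Lx Ly); auto].
  1-4: intros; simpl; field; auto.
  all: apply strict_diff_const.
Qed.
End Cell.

(** One passage through the cell has differential q1 q2 q3 times the identity at the base point, so
    the fixed-point equation is solvable for the three real unknowns of a pair. The factor 1 / (1 -
    q1 q2 q3) is the geometric series of the contributions of all later cells. *)
Lemma weyl_branch (b d H1 H2 H3 : R) (q1 := b ^ 2 / H2 ^ 2) (q2 := b ^ 2 / H3 ^ 2)
    (q3 := d ^ 2 / H1 ^ 2) :
  H1 <> 0 -> H2 <> 0 -> H3 <> 0 ->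
  H1 = b - b ^ 2 / H2 -> H2 = d - b ^ 2 / H3 -> H3 = b - d ^ 2 / H1 -> q1 * q2 * q3 < 1 ->
  exists w : Ek -> weyl,
    weyl_diff Ek w H1 (fun z => (1 + q1 + q1 * q2) / (1 - q1 * q2 * q3) * fst z) (fun _ => 0)
      (fun z => (q1 * d + q1 * q2 * (d ^ 2 / H1)) / (1 - q1 * q2 * q3) * snd z) /\
    near Ek (fun z => w z = site1 b (fst z) (site2 b d (fst z) (snd z) (site3 b d (fst z) (snd z) (w z)))).
Proof.
  intros N1 N2 N3 E1 E2 E3 Hq.
  set (T := padd (padd (padd Ek))).
  set (e := fun z : T => fst (fst (fst (fst z)))).
  set (k := fun z : T => snd (fst (fst (fst z)))).
  assert (He : strict_diff T e 0 e).
  { exact (strict_diff_fst _ _ _ _ (strict_diff_fst _ _ _ _ (strict_diff_fst _ _ _ _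
      (strict_diff_fst _ _ _ _ strict_diff_id)))). }
  assert (Hk : strict_diff T k 0 k).
  { exact (strict_diff_fst _ _ _ _ (strict_diff_fst _ _ _ _ (strict_diff_fst _ _ _ _
      (strict_diff_snd Rspace)))). }
  (* The unknowns are g, Re h - H1 and Im h, all zero at the base point. *)
  set (w := fun z : T => (snd (fst (fst z)), (H1 + snd (fst z), snd z)) : weyl).
  assert (Hw : weyl_diff T w H1 (fun z : T => snd (fst (fst z))) (fun z : T => snd (fst z)) (fun z : T => snd z)).
  { split; [|split].
    - exact (strict_diff_fst _ _ _ _ (strict_diff_fst _ _ _ _ (strict_diff_snd Ek))).
    - eapply strict_diff_ext; [| | |exact (strict_diff_plus _ _ _ _ _ _ _ (strict_diff_const T H1)
        (strict_diff_fst _ _ _ _ (strict_diff_snd (padd Ek))))]; intros; simpl; ring.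
    - apply strict_diff_snd. }
  assert (W3 := weyl_diff_site3 T e k e k w _ _ _ b d H1 N1 He Hk Hw); rewrite <- E3 in W3.
  assert (W2 := weyl_diff_site2 T e k e k _ _ _ _ b d H3 N3 He Hk W3); rewrite <- E2 in W2.
  assert (W1 := weyl_diff_site1 T e e _ _ _ _ b H2 N2 He W2); rewrite <- E1 in W1.
  destruct W1 as [Wg [Wx Wy]]; destruct Hw as [Vg [Vx Vy]].
  assert (m1 := strict_diff_const T (-1)).
  destruct (strict_diff_implicit3 Ek
    (fun p => fst (site1 b (e p) (site2 b d (e p) (k p) (site3 b d (e p) (k p) (w p)))) + -1 * fst (w p))
    (fun p => fst (snd (site1 b (e p) (site2 b d (e p) (k p) (site3 b d (e p) (k p) (w p))))) + -1 * fst (snd (w p)))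
    (fun p => snd (snd (site1 b (e p) (site2 b d (e p) (k p) (site3 b d (e p) (k p) (w p))))) + -1 * snd (snd (w p)))
    (fun z => (1 + q1 + q1 * q2) * fst z) (fun _ => 0)
    (fun z => (q1 * d + q1 * q2 * (d ^ 2 / H1)) * snd z) (q1 * q2 * q3 - 1))
    as [x1 [x2 [x3 [D1 [D2 [D3 N]]]]]].
  - lra.
  - eapply strict_diff_ext; [| | |exact (strict_diff_plus _ _ _ _ _ _ _ Wg (strict_diff_mult _ _ _ _ _ _ _ m1 Vg))];
      intros; simpl; fold q1 q2 q3; auto; unfold e; try ring.
    unfold q1, q2, q3; simpl; field; auto.
  - eapply strict_diff_ext; [| | |exact (strict_diff_plus _ _ _ _ _ _ _ Wx (strict_diff_mult _ _ _ _ _ _ _ m1 Vx))];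
      intros; simpl; auto; try ring.
    unfold q1, q2, q3; simpl; field; auto.
  - eapply strict_diff_ext; [| | |exact (strict_diff_plus _ _ _ _ _ _ _ Wy (strict_diff_mult _ _ _ _ _ _ _ m1 Vy))];
      intros; simpl; auto; unfold k; try ring.
    unfold q1, q2, q3; simpl; field; auto.
  - exists (fun z => (x1 z, (H1 + x2 z, x3 z))); split.
    + split; [|split].
      * eapply strict_diff_ext; [| | |exact D1]; intros; simpl; auto; field; lra.
      * eapply strict_diff_ext; [| | |exact (strict_diff_plus _ _ _ _ _ _ _ (strict_diff_const Ek H1) D2)];
          intros; simpl; auto; field; lra.
      * eapply strict_diff_ext; [| | |exact D3]; intros; simpl; auto; field; lra.
    + revert N; apply near_imp; intros z [A1 [A2 A3]].
      unfold e, k, w in A1, A2, A3; cbn [fst snd] in A1, A2, A3.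
      destruct (site1 b (fst z) (site2 b d (fst z) (snd z)
        (site3 b d (fst z) (snd z) (x1 z, (H1 + x2 z, x3 z))))) as [g [x y]].
      cbn [fst snd] in A1, A2, A3; repeat f_equal; lra.
Qed.

(** * Decaying solutions on a half-line *)

Lemma Cmod_sq (z : C) : Cmod z ^ 2 = fst z ^ 2 + snd z ^ 2.
Proof. unfold Cmod; rewrite pow2_sqrt; auto; nra. Qed.

Lemma wden_factor (w : weyl) :
  wden w = (Cmod (snd w) - Rabs (fst w)) * (Cmod (snd w) + Rabs (fst w)).
Proof.
  unfold wden; rewrite <- (Cmod_sq (snd w)), <- (pow2_abs (fst w)); ring.
Qed.

Lemma wden_pos (w : weyl) : Rabs (fst w) < Cmod (snd w) -> 0 < wden w.
Proof. intros H; rewrite wden_factor; pose proof (Rabs_pos (fst w)); nra. Qed.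

(** When positive, |h| - |g| is the smaller singular value of the real-linear map [w], so the
    inverse of [w] has norm at most 1 / m. *)
Lemma wnext_bound (be : C) (w : weyl) (v : C) (m : R) : 0 < m -> m <= Cmod (snd w) - Rabs (fst w) ->
  Cmod (wnext be w v) <= Cmod be / m * Cmod v.
Proof.
  intros Hm H; pose proof (Rabs_pos (fst w)) as Hg.
  assert (HD : 0 < wden w) by (apply wden_pos; lra).
  assert (HDC : RtoC (wden w) <> 0%C) by (intros E; apply RtoC_inj in E; lra).
  unfold wnext; rewrite Cmod_conj, Cmod_div by auto.
  rewrite Cmod_R, (Rabs_right (wden w)) by lra.
  apply Rmult_le_reg_r with (wden w); auto.
  unfold Rdiv at 1; rewrite Rmult_assoc, Rinv_l, Rmult_1_r by lra.
  unfold Cminus; eapply Rle_trans; [apply Cmod_triangle|].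
  rewrite Cmod_opp, !Cmod_mult, !Cmod_conj, Cmod_R, wden_factor.
  pose proof (Cmod_ge_0 be); pose proof (Cmod_ge_0 v); pose proof (Cmod_ge_0 (snd w)).
  assert (1 <= / m * (Cmod (snd w) - Rabs (fst w))).
  { apply Rmult_le_reg_l with m; auto; rewrite <- Rmult_assoc, Rinv_r by lra; lra. }
  set (X := Cmod be * Cmod v * (Cmod (snd w) + Rabs (fst w))).
  assert (0 <= X) by (unfold X; repeat apply Rmult_le_pos; lra).
  replace (Cmod be / m * Cmod v * ((Cmod (snd w) - Rabs (fst w)) * (Cmod (snd w) + Rabs (fst w))))
    with (X * (/ m * (Cmod (snd w) - Rabs (fst w)))) by (unfold X, Rdiv; ring).
  apply Rle_trans with X; [unfold X; lra|nra].
Qed.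

Lemma weyl_diff_gap (S : pspace) (w : S -> weyl) H Lg Lx Ly m : m < Rabs H ->
  weyl_diff S w H Lg Lx Ly -> near S (fun z => m <= Cmod (snd (w z)) - Rabs (fst (w z))).
Proof.
  intros Hm [Hg [Hx _]].
  assert (N1 := strict_diff_near _ _ _ _ ((Rabs H - m) / 2) Hg ltac:(lra)).
  assert (N2 := strict_diff_near _ _ _ _ ((Rabs H - m) / 2) Hx ltac:(lra)).
  refine (near_imp _ _ _ _ (near_and _ _ _ N1 N2)); intros z [A B].
  rewrite Rminus_0_r in A.
  pose proof (Rmax_Cmod (snd (w z))) as C1.
  pose proof (Rmax_l (Rabs (fst (snd (w z)))) (Rabs (snd (snd (w z))))).
  pose proof (Rabs_triang_inv H (H - fst (snd (w z)))) as C2.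
  replace (H - (H - fst (snd (w z)))) with (fst (snd (w z))) in C2 by ring.
  rewrite Rabs_minus_sym in B; lra.
Qed.

(** The left bond of the first site is kept open: [hl_weyl] says that all other terms of its
    equation add up to [wapply w a], so that only the interface term remains to be matched. *)
Record decaying_half_line (b d E k : R) (w : weyl) (a : C) (v1 v2 v3 : nat -> C) : Prop := {
  hl_start : v1 O = a;
  hl_weyl : wapply w a = (RtoC E * v1 O + RtoC b * Cconj (v1 O) + RtoC b * Cconj (v2 O))%C;
  hl_site1 : forall n, (RtoC E * v1 (S n) + RtoC b * Cconj (v1 (S n)) + RtoC b * Cconj (v2 (S n))
    + RtoC d * expi (- k / 2) * Cconj (v3 n))%C = 0%C;
  hl_site2 : forall n, (RtoC E * v2 n + RtoC d * expi k * Cconj (v2 n) + RtoC b * Cconj (v3 n)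
    + RtoC b * Cconj (v1 n))%C = 0%C;
  hl_site3 : forall n, (RtoC E * v3 n + RtoC b * Cconj (v3 n)
    + RtoC d * expi (- k / 2) * Cconj (v1 (S n)) + RtoC b * Cconj (v2 n))%C = 0%C;
  hl_decay : exists K rho, 0 <= rho < 1 /\ forall n,
    Cmod (v1 n) <= K * rho ^ n /\ Cmod (v2 n) <= K * rho ^ n /\ Cmod (v3 n) <= K * rho ^ n }.

Lemma Cmod_expi (t : R) : Cmod (expi t) = 1.
Proof.
  unfold Cmod, expi; simpl.
  replace (cos t * (cos t * 1) + sin t * (sin t * 1)) with 1; [apply sqrt_1|].
  pose proof (sin2_cos2 t); unfold Rsqr in *; lra.
Qed.

(** Because the pairs repeat from cell to cell, [wnext] can be iterated for ever. The three bounds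
    of [wnext_bound] multiply to the factor b b d / (m1 m2 m3) < 1 per cell. *)
Lemma decaying_half_line_exists (b d E k m1 m2 m3 : R) (w1 w2 w3 : weyl) (a : C) :
  0 < b -> 0 < d -> 0 < m1 -> 0 < m2 -> 0 < m3 ->
  m1 <= Cmod (snd w1) - Rabs (fst w1) -> m2 <= Cmod (snd w2) - Rabs (fst w2) ->
  m3 <= Cmod (snd w3) - Rabs (fst w3) -> b * b * d < m1 * m2 * m3 ->
  w1 = site1 b E w2 -> w2 = site2 b d E k w3 -> w3 = site3 b d E k w1 ->
  exists v1 v2 v3, decaying_half_line b d E k w1 a v1 v2 v3.
Proof.
  intros Hb Hd M1 M2 M3 G1 G2 G3 Hm E1 E2 E3.
  set (om := (RtoC d * expi (- k / 2))%C).
  set (s2 := wnext (RtoC b) w2); set (s3 := wnext (RtoC b) w3); set (s1 := wnext om w1).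
  set (v1 := fix v1 n := match n with O => a | S n => s1 (s3 (s2 (v1 n))) end).
  assert (D1 : wden w1 <> 0) by (apply Rgt_not_eq, wden_pos; lra).
  assert (D2 : wden w2 <> 0) by (apply Rgt_not_eq, wden_pos; lra).
  assert (D3 : wden w3 <> 0) by (apply Rgt_not_eq, wden_pos; lra).
  assert (A1 : forall v, wapply w1 v = (RtoC E * v + RtoC b * Cconj v + RtoC b * Cconj (s2 v))%C).
  { intros v; rewrite E1 at 1; apply wapply_step; auto. }
  assert (A2 : forall v, wapply w2 v = (RtoC E * v + RtoC d * expi k * Cconj v + RtoC b * Cconj (s3 v))%C).
  { intros v; rewrite E2 at 1; apply wapply_step; auto. }
  assert (A3 : forall v, wapply w3 v = (RtoC E * v + RtoC b * Cconj v + om * Cconj (s1 v))%C).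
  { intros v; rewrite E3 at 1; apply wapply_step; auto. }
  exists v1, (fun n => s2 (v1 n)), (fun n => s3 (s2 (v1 n))); split.
  - reflexivity.
  - apply A1.
  - intros n; change (v1 (S n)) with (s1 (s3 (s2 (v1 n)))); rewrite <- A1.
    unfold s1 at 1; rewrite wapply_next by auto; fold om; ring.
  - intros n; rewrite <- A2; unfold s2 at 1; rewrite wapply_next by auto; ring.
  - intros n; change (v1 (S n)) with (s1 (s3 (s2 (v1 n)))); fold om; rewrite <- A3.
    unfold s3 at 1; rewrite wapply_next by auto; ring.
  - assert (B1 : forall v, Cmod (s1 v) <= d / m1 * Cmod v).
    { intros v; eapply Rle_trans; [apply (wnext_bound _ _ _ m1); auto|].
      unfold om; rewrite Cmod_mult, Cmod_expi, Cmod_R, Rabs_right by lra; lra. }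
    assert (B2 : forall v, Cmod (s2 v) <= b / m2 * Cmod v).
    { intros v; eapply Rle_trans; [apply (wnext_bound _ _ _ m2); auto|].
      rewrite Cmod_R, Rabs_right by lra; lra. }
    assert (B3 : forall v, Cmod (s3 v) <= b / m3 * Cmod v).
    { intros v; eapply Rle_trans; [apply (wnext_bound _ _ _ m3); auto|].
      rewrite Cmod_R, Rabs_right by lra; lra. }
    assert (P1 : 0 < d / m1) by (apply Rdiv_lt_0_compat; lra).
    assert (P2 : 0 < b / m2) by (apply Rdiv_lt_0_compat; lra).
    assert (P3 : 0 < b / m3) by (apply Rdiv_lt_0_compat; lra).
    set (rho := d / m1 * (b / m3 * (b / m2))).
    assert (R0 : 0 <= rho) by (apply Rlt_le, Rmult_lt_0_compat; [|apply Rmult_lt_0_compat]; auto).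
    assert (R1 : rho < 1).
    { assert (0 < m1 * m2 * m3) by (repeat apply Rmult_lt_0_compat; auto).
      replace rho with (b * b * d / (m1 * m2 * m3)) by (unfold rho; field; repeat split; lra).
      apply Rlt_div_l; lra. }
    assert (V1 : forall n, Cmod (v1 n) <= Cmod a * rho ^ n).
    { induction n as [|n IH]; [simpl; lra|].
      change (v1 (S n)) with (s1 (s3 (s2 (v1 n)))).
      eapply Rle_trans; [apply B1|].
      eapply Rle_trans; [apply Rmult_le_compat_l; [lra|apply B3]|].
      eapply Rle_trans; [apply Rmult_le_compat_l; [lra|apply Rmult_le_compat_l; [lra|apply B2]]|].
      simpl; replace (d / m1 * (b / m3 * (b / m2 * Cmod (v1 n)))) with (rho * Cmod (v1 n)) by (unfold rho; ring).
      replace (Cmod a * (rho * rho ^ n)) with (rho * (Cmod a * rho ^ n)) by ring.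
      apply Rmult_le_compat_l; auto. }
    exists (Cmod a * (1 + b / m2 + b / m3 * (b / m2))), rho; split; [lra|]; intros n.
    specialize (V1 n); specialize (B2 (v1 n)) as C2; specialize (B3 (s2 (v1 n))) as C3.
    pose proof (Cmod_ge_0 a); pose proof (pow_le rho n R0).
    assert (0 <= Cmod a * rho ^ n) by (apply Rmult_le_pos; auto).
    assert (0 < b / m3 * (b / m2)) by (apply Rmult_lt_0_compat; auto).
    assert (Cmod (s2 (v1 n)) <= b / m2 * (Cmod a * rho ^ n)) by nra.
    assert (Cmod (s3 (s2 (v1 n))) <= b / m3 * (b / m2 * (Cmod a * rho ^ n))) by nra.
    assert (0 <= b / m2 * (Cmod a * rho ^ n)) by nra.
    assert (0 <= b / m3 * (b / m2 * (Cmod a * rho ^ n))) by nra.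
    lra.
Qed.

(** The condition q1 q2 q3 < 1 means b b d < |H1 H2 H3|. The gaps |h| - |g| equal |H1|, |H2|, |H3|
    at the base point, so nearby they still have a product above b b d. *)
Lemma half_line_branch (b d H1 H2 H3 : R) (q1 := b ^ 2 / H2 ^ 2) (q2 := b ^ 2 / H3 ^ 2)
    (q3 := d ^ 2 / H1 ^ 2) : 0 < b -> 0 < d ->
  H1 <> 0 -> H2 <> 0 -> H3 <> 0 ->
  H1 = b - b ^ 2 / H2 -> H2 = d - b ^ 2 / H3 -> H3 = b - d ^ 2 / H1 -> q1 * q2 * q3 < 1 ->
  exists w : Ek -> weyl,
    weyl_diff Ek w H1 (fun z => (1 + q1 + q1 * q2) / (1 - q1 * q2 * q3) * fst z) (fun _ => 0)
      (fun z => (q1 * d + q1 * q2 * (d ^ 2 / H1)) / (1 - q1 * q2 * q3) * snd z) /\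
    near Ek (fun z => wden (w z) <> 0 /\ forall a, exists v1 v2 v3,
      decaying_half_line b d (fst z) (snd z) (w z) a v1 v2 v3).
Proof.
  intros Hb Hd N1 N2 N3 E1 E2 E3 Hq.
  destruct (weyl_branch b d H1 H2 H3 N1 N2 N3 E1 E2 E3 Hq) as [w [W1 Nw]].
  exists w; split; [exact W1|].
  assert (He : strict_diff Ek (fun z => fst z) 0 (fun z => fst z)) by exact (strict_diff_fst _ _ _ _ strict_diff_id).
  assert (Hk : strict_diff Ek (fun z => snd z) 0 (fun z => snd z)) by apply strict_diff_snd.
  assert (W3 := weyl_diff_site3 Ek _ _ _ _ w _ _ _ b d H1 N1 He Hk W1); rewrite <- E3 in W3.
  assert (W2 := weyl_diff_site2 Ek _ _ _ _ _ _ _ _ b d H3 N3 He Hk W3); rewrite <- E2 in W2.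
  assert (P1 := Rabs_pos_lt _ N1); assert (P2 := Rabs_pos_lt _ N2); assert (P3 := Rabs_pos_lt _ N3).
  set (P := Rabs H1 * Rabs H2 * Rabs H3).
  assert (HP : 0 < P) by (unfold P; repeat apply Rmult_lt_0_compat; auto).
  assert (Hlt : b * b * d < P).
  { apply Rnot_le_lt; intros Hle; apply (Rlt_irrefl 1); eapply Rle_lt_trans; [|exact Hq].
    assert (HP2 : P ^ 2 <= (b * b * d) ^ 2) by (apply pow_incr; lra).
    assert (HPe : P ^ 2 = (H1 * H2 * H3) ^ 2).
    { unfold P; rewrite <- !Rabs_mult, pow2_abs; ring. }
    replace (q1 * q2 * q3) with ((b * b * d) ^ 2 * / (H1 * H2 * H3) ^ 2)
      by (unfold q1, q2, q3; field; auto).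
    rewrite <- HPe; apply Rmult_le_reg_r with (P ^ 2); [apply pow_lt; auto|].
    rewrite Rmult_assoc, Rinv_l; [lra|apply pow_nonzero; lra]. }
  (* Then b b d = (1 - 4 eps) P, and (1 - eps)^3 > 1 - 4 eps. *)
  set (eps := (1 - b * b * d / P) / 4).
  assert (0 < b * b * d / P < 1).
  { split; [apply Rdiv_lt_0_compat; [repeat apply Rmult_lt_0_compat|]; auto|apply Rlt_div_l; lra]. }
  assert (He0 : 0 < eps < / 4) by (unfold eps; lra).
  assert (Hprod : b * b * d < (1 - eps) * Rabs H1 * ((1 - eps) * Rabs H2) * ((1 - eps) * Rabs H3)).
  { replace ((1 - eps) * Rabs H1 * ((1 - eps) * Rabs H2) * ((1 - eps) * Rabs H3)) with
      ((1 - eps) ^ 3 * P) by (unfold P; ring).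
    replace (b * b * d) with ((1 - 4 * eps) * P) by (unfold eps; field; lra).
    apply Rmult_lt_compat_r; auto; nra. }
  assert (G1 := weyl_diff_gap _ _ H1 _ _ _ ((1 - eps) * Rabs H1) ltac:(nra) W1).
  assert (G2 := weyl_diff_gap _ _ H2 _ _ _ ((1 - eps) * Rabs H2) ltac:(nra) W2).
  assert (G3 := weyl_diff_gap _ _ H3 _ _ _ ((1 - eps) * Rabs H3) ltac:(nra) W3).
  refine (near_imp _ _ _ _ (near_and _ _ _ Nw (near_and _ _ _ G1 (near_and _ _ _ G2 G3)))).
  intros z [Hw [B1 [B2 B3]]].
  assert (0 < (1 - eps) * Rabs H1) by nra.
  assert (0 < (1 - eps) * Rabs H2) by nra.
  assert (0 < (1 - eps) * Rabs H3) by nra.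
  split; [apply Rgt_not_eq, wden_pos; lra|]; intros a.
  eapply (decaying_half_line_exists b d (fst z) (snd z)); [| | | | |exact B1|exact B2|exact B3| | | |]; auto.
Qed.

(** * Matching at the interface *)

Lemma expi_plus (s t : R) : expi (s + t) = (expi s * expi t)%C.
Proof.
  unfold expi; rewrite cos_plus, sin_plus; apply injective_projections; simpl; ring.
Qed.

Lemma Cconj_expi (t : R) : Cconj (expi t) = expi (- t).
Proof. unfold expi, Cconj; simpl; rewrite cos_neg, sin_neg; reflexivity. Qed.

Lemma Cconj_RtoC (x : R) : Cconj (RtoC x) = RtoC x.
Proof. unfold Cconj, RtoC; simpl; f_equal; ring. Qed.

(** The phase undoes the gauge change. The sign s = 1 gives the symmetric state; s = -1 flips
    components 4, 5, 6 and thereby the sign of the energy. *)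
Definition gauge_state (k s : R) (v1 v2 v3 : Z -> C) : state := fun n j =>
  (expi (- k * IZR n / 2) *
   match j with
   | I1 => v1 n | I2 => v2 n | I3 => v3 n
   | I4 => RtoC s * Cconj (v1 n) | I5 => RtoC s * Cconj (v2 n) | I6 => RtoC s * Cconj (v3 n)
   end)%C.

Lemma gauge_state_eigen (bp bm dp dm c k E s : R) (v1 v2 v3 : Z -> C) : s * s = 1 ->
  (forall n, (RtoC E * v1 n + RtoC (bcoef bp bm n) * Cconj (v1 n) + RtoC (bcoef bp bm n) * Cconj (v2 n)
     + RtoC (ccoef bp bm dp dm c (n - 1)) * expi (- k / 2) * Cconj (v3 (n - 1)%Z))%C = 0%C) ->
  (forall n, (RtoC E * v2 n + RtoC (dcoef bp bm dp dm n) * expi k * Cconj (v2 n)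
     + RtoC (bcoef bp bm n) * Cconj (v3 n) + RtoC (bcoef bp bm n) * Cconj (v1 n))%C = 0%C) ->
  (forall n, (RtoC E * v3 n + RtoC (bcoef bp bm n) * Cconj (v3 n)
     + RtoC (ccoef bp bm dp dm c n) * expi (- k / 2) * Cconj (v1 (n + 1)%Z)
     + RtoC (bcoef bp bm n) * Cconj (v2 n))%C = 0%C) ->
  forall n j, HI bp bm dp dm c k (gauge_state k s v1 v2 v3) n j =
    (RtoC (s * E) * gauge_state k s v1 v2 v3 n j)%C.
Proof.
  intros Hs Q1 Q2 Q3 n j.
  assert (Hss : (RtoC s * RtoC s = 1)%C) by (rewrite <- RtoC_mult, Hs; reflexivity).
  specialize (Q1 n); specialize (Q2 n); specialize (Q3 n).
  (* Rows 1 to 3 of the eigenvalue equation are the chain equations, rows 4 to 6 their complex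
     conjugates, where s s = 1 absorbs the sign. *)
  assert (C1 := f_equal Cconj Q1); assert (C2 := f_equal Cconj Q2); assert (C3 := f_equal Cconj Q3).
  rewrite !Cplus_conj, !Cmult_conj, !Cconj_conj, !Cconj_RtoC, Cconj_expi in C1, C2, C3.
  replace (- (- k / 2)) with (k / 2) in C1, C3 by field.
  unfold HI, gauge_state.
  (* Moving by one cell multiplies the gauge phase by e^(ik/2) or e^(-ik/2), which turns the
     intercell phases of [HI] into half phases. *)
  assert (Pm : expi (- k * IZR (n - 1) / 2) = (expi (- k * IZR n / 2) * expi (k / 2))%C).
  { rewrite <- expi_plus, minus_IZR; f_equal; field. }
  assert (Pp : expi (- k * IZR (n + 1) / 2) = (expi (- k * IZR n / 2) * expi (- k / 2))%C).
  { rewrite <- expi_plus, plus_IZR; f_equal; field. }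
  assert (Pw : (expi (- k) * expi (k / 2) = expi (- k / 2))%C).
  { rewrite <- expi_plus; f_equal; field. }
  assert (Pw' : (expi k * expi (- k / 2) = expi (k / 2))%C).
  { rewrite <- expi_plus; f_equal; field. }
  rewrite Pm, Pp, RtoC_mult.
  set (P := expi (- k * IZR n / 2)) in *.
  generalize dependent (RtoC s); intros sC HsC.
  generalize dependent (RtoC E); intros EC Q1 Q2 Q3 C1 C2 C3.
  destruct j.
  - transitivity (sC * P * (EC * v1 n - (EC * v1 n + RtoC (bcoef bp bm n) * Cconj (v1 n) + RtoC (bcoef bp bm n) * Cconj (v2 n)
     + RtoC (ccoef bp bm dp dm c (n - 1)) * (expi (- k) * expi (k / 2)) * Cconj (v3 (n - 1)%Z))))%C; [ring|].
    rewrite Pw, Q1; ring.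
  - transitivity (sC * P * (EC * v2 n - (EC * v2 n + RtoC (dcoef bp bm dp dm n) * expi k * Cconj (v2 n)
     + RtoC (bcoef bp bm n) * Cconj (v3 n) + RtoC (bcoef bp bm n) * Cconj (v1 n))))%C; [ring|].
    rewrite Q2; ring.
  - transitivity (sC * P * (EC * v3 n - (EC * v3 n + RtoC (bcoef bp bm n) * Cconj (v3 n)
     + RtoC (ccoef bp bm dp dm c n) * expi (- k / 2) * Cconj (v1 (n + 1)%Z)
     + RtoC (bcoef bp bm n) * Cconj (v2 n))))%C; [ring|].
    rewrite Q3; ring.
  - transitivity (P * (EC * Cconj (v1 n) - (EC * Cconj (v1 n) + RtoC (bcoef bp bm n) * v1 n + RtoC (bcoef bp bm n) * v2 n
     + RtoC (ccoef bp bm dp dm c (n - 1)) * expi (k / 2) * v3 (n - 1)%Z)))%C; [ring|].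
    rewrite C1; transitivity ((sC * sC) * (EC * (P * Cconj (v1 n))))%C; [rewrite HsC|]; ring.
  - transitivity (P * (EC * Cconj (v2 n) - (EC * Cconj (v2 n) + RtoC (dcoef bp bm dp dm n) * expi (- k) * v2 n
     + RtoC (bcoef bp bm n) * v3 n + RtoC (bcoef bp bm n) * v1 n)))%C; [ring|].
    rewrite C2; transitivity ((sC * sC) * (EC * (P * Cconj (v2 n))))%C; [rewrite HsC|]; ring.
  - transitivity (P * (EC * Cconj (v3 n) - (EC * Cconj (v3 n) + RtoC (bcoef bp bm n) * v3 n
     + RtoC (ccoef bp bm dp dm c n) * (expi k * expi (- k / 2)) * v1 (n + 1)%Z
     + RtoC (bcoef bp bm n) * v2 n)))%C; [ring|].
    rewrite Pw', C3; transitivity ((sC * sC) * (EC * (P * Cconj (v3 n))))%C; [rewrite HsC|]; ring.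
Qed.

Lemma gauge_state_nsq (k s : R) (v1 v2 v3 : Z -> C) (n : Z) (B : R) : s * s = 1 ->
  Cmod (v1 n) <= B -> Cmod (v2 n) <= B -> Cmod (v3 n) <= B ->
  site_nsq (gauge_state k s v1 v2 v3) n <= 6 * B ^ 2.
Proof.
  intros Hs B1 B2 B3; unfold site_nsq, gauge_state.
  rewrite !Cmod_mult, !Cmod_conj, Cmod_expi, Cmod_R, !Rpow_mult_distr, pow2_abs.
  replace (s ^ 2) with 1 by (rewrite <- Hs; ring).
  assert (forall v, Cmod v <= B -> Cmod v ^ 2 <= B ^ 2).
  { intros v Hv; apply pow_incr; split; auto; apply Cmod_ge_0. }
  pose proof (H _ B1); pose proof (H _ B2); pose proof (H _ B3); nra.
Qed.

Lemma site_nsq_ge0 (u : state) (n : Z) : 0 <= site_nsq u n.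
Proof. unfold site_nsq; nra. Qed.

Lemma in_l2_of_geometric (u : state) (K rho : R) : 0 <= rho < 1 ->
  (forall m : nat, site_nsq u (Z.of_nat m) <= K * (rho ^ m) ^ 2 /\
                   site_nsq u (- Z.of_nat m - 1)%Z <= K * (rho ^ m) ^ 2) ->
  in_l2 u.
Proof.
  intros Hr H; unfold in_l2.
  apply (ex_series_le (K := R_AbsRing) (V := R_CompleteNormedModule) _ (fun m => 2 * K * (rho ^ 2) ^ m)).
  - intros m; destruct (H m) as [A B].
    pose proof (site_nsq_ge0 u (Z.of_nat m)); pose proof (site_nsq_ge0 u (- Z.of_nat m - 1)).
    unfold norm; simpl; unfold abs; simpl; rewrite Rabs_right by lra.
    replace ((rho * (rho * 1)) ^ m) with ((rho ^ m) ^ 2) by (rewrite <- !pow_mult, Nat.mul_comm, pow_mult; simpl; auto).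
    lra.
  - apply (ex_series_scal (K := R_AbsRing) (V := R_NormedModule) (2 * K) (fun m => (rho ^ 2) ^ m)), ex_series_geom; rewrite Rabs_right by nra; nra.
Qed.

Lemma Z_cases (n : Z) : (exists m : nat, n = Z.of_nat m) \/ (exists m : nat, n = (- Z.of_nat m - 1)%Z).
Proof.
  destruct (Z_le_dec 0 n); [left; exists (Z.to_nat n)|right; exists (Z.to_nat (- n - 1))]; lia.
Qed.

Definition glue (f g : nat -> C) (n : Z) : C :=
  if (0 <=? n)%Z then f (Z.to_nat n) else g (Z.to_nat (- n - 1)).

Lemma glue_right (f g : nat -> C) (m : nat) : glue f g (Z.of_nat m) = f m.
Proof.
  unfold glue; destruct (Z.leb_spec 0 (Z.of_nat m)); [now rewrite Nat2Z.id|lia].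
Qed.

Lemma glue_left (f g : nat -> C) (m : nat) : glue f g (- Z.of_nat m - 1) = g m.
Proof.
  unfold glue; destruct (Z.leb_spec 0 (- Z.of_nat m - 1)); [lia|].
  replace (- (- Z.of_nat m - 1) - 1)%Z with (Z.of_nat m) by ring; now rewrite Nat2Z.id.
Qed.

Lemma bcoef_right bp bm (m : nat) : bcoef bp bm (Z.of_nat m) = bp.
Proof. unfold bcoef; destruct (Z.leb_spec 0 (Z.of_nat m)); auto; lia. Qed.
Lemma bcoef_left bp bm (m : nat) : bcoef bp bm (- Z.of_nat m - 1) = bm.
Proof. unfold bcoef; destruct (Z.leb_spec 0 (- Z.of_nat m - 1)); auto; lia. Qed.
Lemma dcoef_right bp bm dp dm (m : nat) : dcoef bp bm dp dm (Z.of_nat m) = bp + dp.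
Proof. unfold dcoef; destruct (Z.leb_spec 0 (Z.of_nat m)); auto; lia. Qed.
Lemma dcoef_left bp bm dp dm (m : nat) : dcoef bp bm dp dm (- Z.of_nat m - 1) = bm + dm.
Proof. unfold dcoef; destruct (Z.leb_spec 0 (- Z.of_nat m - 1)); auto; lia. Qed.
Lemma ccoef_right bp bm dp dm c (m : nat) : ccoef bp bm dp dm c (Z.of_nat m) = bp + dp.
Proof. unfold ccoef; destruct (Z.leb_spec 0 (Z.of_nat m)); auto; lia. Qed.
(** The bond of index -1 is the interface bond, so the uniform left bonds start one cell further
    out, at [S m]. *)
Lemma ccoef_left bp bm dp dm c (m : nat) : ccoef bp bm dp dm c (- Z.of_nat (S m) - 1) = bm + dm.
Proof.
  unfold ccoef; destruct (Z.leb_spec 0 (- Z.of_nat (S m) - 1)); [lia|].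
  destruct (Z.eqb_spec (- Z.of_nat (S m) - 1) (-1)); auto; lia.
Qed.

(* The left half-line is read from right to left, so sites 1 and 3 are exchanged there. *)
Lemma glued_eigenvalue (bp bm dp dm c k E s : R) (wp wm : weyl) (a e : C)
    (v1 v2 v3 y1 y2 y3 : nat -> C) : s * s = 1 -> a <> 0%C ->
  decaying_half_line bp (bp + dp) E k wp a v1 v2 v3 ->
  decaying_half_line bm (bm + dm) E k wm e y1 y2 y3 ->
  (wapply wp a + RtoC c * expi (- k / 2) * Cconj e)%C = 0%C ->
  (wapply wm e + RtoC c * expi (- k / 2) * Cconj a)%C = 0%C ->
  is_eigenvalue bp bm dp dm c k (s * E).
Proof.
  intros Hs Ha V Y Mp Mm.
  destruct V as [V0 VW V1 V2 V3 [Kv [rv [Rv Dv]]]].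
  destruct Y as [Y0 YW Y1 Y2 Y3 [Ky [ry [Ry Dy]]]].
  exists (gauge_state k s (glue v1 y3) (glue v2 y2) (glue v3 y1)); split; [|split].
  (* The constants [Kv] and [Ky] carry no sign, hence the absolute values in the common bound. *)
  - set (rho := Rmax rv ry); set (K := Rmax (Rabs Kv) (Rabs Ky)).
    pose proof (Rmax_l rv ry); pose proof (Rmax_r rv ry).
    pose proof (Rmax_l (Rabs Kv) (Rabs Ky)); pose proof (Rmax_r (Rabs Kv) (Rabs Ky)).
    fold rho K in H, H0, H1, H2.
    assert (Hb : forall Q r n, Rabs Q <= K -> 0 <= r <= rho -> Q * r ^ n <= K * rho ^ n).
    { intros Q r n HQ Hr; pose proof (Rabs_pos Q); pose proof (RRle_abs Q).
      pose proof (pow_incr r rho n Hr); pose proof (pow_le r n (proj1 Hr)).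
      apply Rle_trans with (Rabs Q * r ^ n); [nra|]; apply Rmult_le_compat; auto. }
    apply (in_l2_of_geometric _ (6 * K ^ 2) rho).
    + split; [lra|]; unfold rho, Rmax; destruct (Rle_dec rv ry); lra.
    + intros m; specialize (Dv m); specialize (Dy m).
      pose proof (Hb Kv rv m ltac:(lra) ltac:(lra)); pose proof (Hb Ky ry m ltac:(lra) ltac:(lra)).
      replace (6 * K ^ 2 * (rho ^ m) ^ 2) with (6 * (K * rho ^ m) ^ 2) by ring.
      split; apply gauge_state_nsq; auto; rewrite ?glue_right, ?glue_left; lra.
  - exists 0%Z, I1; unfold gauge_state.
    change 0%Z with (Z.of_nat 0) at 2; rewrite glue_right, V0; intros Heq.
    apply (f_equal Cmod) in Heq; rewrite Cmod_mult, Cmod_expi, Rmult_1_l, Cmod_0 in Heq.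
    now apply Ha, Cmod_eq_0.
  - apply gauge_state_eigen; auto; intros n; destruct (Z_cases n) as [[m ->]|[m ->]].
    + destruct m as [|m].
      (* The interface: the neighbour of site 1 in cell 0 is site 3 of cell -1, which carries
         [y1 0], that is [e]. *)
      * replace (Z.of_nat 0 - 1)%Z with (- Z.of_nat 0 - 1)%Z by lia.
        rewrite !glue_right, glue_left, bcoef_right.
        change (ccoef bp bm dp dm c (- Z.of_nat 0 - 1)) with c.
        rewrite <- VW, Y0; exact Mp.
      * replace (Z.of_nat (S m) - 1)%Z with (Z.of_nat m) by lia.
        rewrite !glue_right, bcoef_right, ccoef_right; apply V1.
    + replace (- Z.of_nat m - 1 - 1)%Z with (- Z.of_nat (S m) - 1)%Z by lia.
      rewrite !glue_left, bcoef_left, ccoef_left; rewrite <- (Y3 m); ring.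
    + rewrite !glue_right, bcoef_right, dcoef_right; apply V2.
    + rewrite !glue_left, bcoef_left, dcoef_left; rewrite <- (Y2 m); ring.
    + replace (Z.of_nat m + 1)%Z with (Z.of_nat (S m)) by lia.
      rewrite !glue_right, bcoef_right, ccoef_right; apply V3.
    + destruct m as [|m].
      * replace (- Z.of_nat 0 - 1 + 1)%Z with (Z.of_nat 0) by lia.
        rewrite !glue_left, glue_right, bcoef_left.
        change (ccoef bp bm dp dm c (- Z.of_nat 0 - 1)) with c.
        rewrite V0, <- Mm, YW; ring.
      * replace (- Z.of_nat (S m) - 1 + 1)%Z with (- Z.of_nat m - 1)%Z by lia.
        rewrite !glue_left, bcoef_left, ccoef_left; rewrite <- (Y1 m); ring.
Qed.

(** For h = x + iy the real-linear map has the matrix with rows (g + x, y) and (y, g - x), singular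
    here. If y is nonzero, a kernel vector is read off the first row. *)
Lemma wapply_kernel (w : weyl) : wden w = 0 -> exists a : C, a <> 0%C /\ wapply w a = 0%C.
Proof.
  destruct w as [g [x y]]; unfold wden, wapply; simpl; intros H.
  destruct (Req_dec y 0) as [Hy|Hy].
  - destruct (Req_dec (g + x) 0) as [Hg|Hg].
    + exists (1, 0); split; [intros E; injection E; lra|].
      apply injective_projections; simpl; nra.
    + exists (0, 1); split; [intros E; injection E; lra|].
      assert (g - x = 0) by (apply Rmult_eq_reg_l with (g + x); auto; nra).
      apply injective_projections; simpl; nra.
  - exists (y, - (g + x)); split; [intros E; injection E; lra|].
    apply injective_projections; simpl; nra.
Qed.

(** Crossing the interface bond is one more elimination step, with [wp] in the place of the site
    coefficients. A kernel vector of the result is the value at site 1 of cell 0, and [wnext] gives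
    the value across the bond. *)
Lemma matched_eigenvalue (bp bm dp dm c k E s : R) (wp wm : weyl) : s * s = 1 ->
  (forall a, exists v1 v2 v3, decaying_half_line bp (bp + dp) E k wp a v1 v2 v3) ->
  (forall a, exists v1 v2 v3, decaying_half_line bm (bm + dm) E k wm a v1 v2 v3) ->
  wden wm <> 0 ->
  wden (wstep (fst wp) (snd wp) (RtoC c * expi (- k / 2))%C wm) = 0 ->
  is_eigenvalue bp bm dp dm c k (s * E).
Proof.
  intros Hs Hp Hm Hd Hz.
  destruct (wapply_kernel _ Hz) as [a [Ha Hk]].
  rewrite wapply_step in Hk by auto.
  set (om := (RtoC c * expi (- k / 2))%C) in *.
  set (e := wnext om wm a) in *.
  destruct (Hp a) as [v1 [v2 [v3 V]]]; destruct (Hm e) as [y1 [y2 [y3 Y]]].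
  apply (glued_eigenvalue bp bm dp dm c k E s wp wm a e v1 v2 v3 y1 y2 y3); auto.
  unfold e; rewrite wapply_next by auto; fold om; ring.
Qed.

(** * The zero mode *)

Lemma geometric_growth_null (e : nat -> R) (mu : R) : 1 <= mu ->
  (forall n, e (S n) = mu * e n) -> is_lim_seq e 0 -> forall n, e n = 0.
Proof.
  intros Hmu He Hl n.
  assert (Hge : forall m, Rabs (e n) <= Rabs (e (m + n)%nat)).
  { induction m as [|m IH]; [simpl; lra|].
    simpl; rewrite He, Rabs_mult, (Rabs_right mu) by lra.
    pose proof (Rabs_pos (e (m + n)%nat)); nra. }
  apply is_lim_seq_abs_0, (is_lim_seq_incr_n _ n) in Hl.
  assert (Rbar_le (Rabs (e n)) 0).
  { apply (is_lim_seq_le (fun _ => Rabs (e n)) (fun m => Rabs (e (m + n)%nat)) (Rabs (e n)) 0); auto.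
    apply is_lim_seq_const. }
  simpl in H; pose proof (Rabs_pos (e n)); apply NNPP; intros Hn; apply Rabs_pos_lt in Hn; lra.
Qed.

(** The characteristic roots are lam and 1 / lam. The combination x (S n) - lam x n is multiplied by
    1 / lam >= 1 at each step, yet tends to 0, so it vanishes. *)
Lemma decaying_recurrence (x : nat -> R) (lam : R) : 0 < lam <= 1 ->
  (forall n, x (S (S n)) = (lam + / lam) * x (S n) - x n) -> is_lim_seq x 0 ->
  forall n, x (S n) = lam * x n.
Proof.
  intros Hl Hx Hlim.
  assert (H : forall n, x (S n) - lam * x n = 0); [|intros n; specialize (H n); lra].
  apply (geometric_growth_null (fun n => x (S n) - lam * x n) (/ lam)).
  - rewrite <- Rinv_1; apply Rinv_le_contravar; lra.
  - intros n; rewrite Hx; field; lra.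
  - replace (Finite 0) with (Rbar_minus 0 (Rbar_mult lam 0)) by (simpl; f_equal; ring).
    apply is_lim_seq_minus'; [now apply (is_lim_seq_incr_1 x)|].
    apply (is_lim_seq_scal_l x lam 0); auto.
Qed.

Lemma constant_null (x : nat -> R) : (forall n, x (S n) = x n) -> is_lim_seq x 0 -> x O = 0.
Proof.
  intros Hx Hl; apply (geometric_growth_null x 1); auto; [lra|intros; rewrite Hx; ring].
Qed.

(** The site-1 equation starts at cell 1, since that of cell 0 contains the interface bond. *)
Record half_line_zero_mode (b d : R) (p1 p2 p3 : nat -> R) : Prop := {
  zm_site2 : forall n, b * p1 n + d * p2 n + b * p3 n = 0;
  zm_site3 : forall n, d * p1 (S n) + b * p2 n + b * p3 n = 0;
  zm_site1 : forall n, b * p1 (S n) + b * p2 (S n) + d * p3 n = 0 }.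

Lemma half_line_zero_mode_unique (b d : R) (p1 p2 p3 : nat -> R) : 0 < b -> 0 < d ->
  half_line_zero_mode b d p1 p2 p3 -> p1 O = 0 -> p2 O = 0 ->
  forall n, p1 n = 0 /\ p2 n = 0 /\ p3 n = 0.
Proof.
  intros Hb Hd [E2 E3 E1] Z1 Z2.
  assert (H : forall n, p1 n = 0 /\ p2 n = 0).
  { induction n as [|n [I1 I2]]; auto.
    specialize (E2 n); specialize (E3 n); specialize (E1 n); rewrite I1, I2 in *.
    assert (p3 n = 0) by (apply Rmult_eq_reg_l with b; lra).
    assert (p1 (S n) = 0) by (apply Rmult_eq_reg_l with d; nra).
    split; auto; apply Rmult_eq_reg_l with b; nra. }
  intros n; destruct (H n) as [I1 I2]; specialize (E2 n); rewrite I1, I2 in E2.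
  repeat split; auto; apply Rmult_eq_reg_l with b; lra.
Qed.

(** The right side is the trace of the zero-energy transfer matrix over one cell, which has
    determinant 1. It exceeds 2 by (d - b)^2 (d + 2 b) / (d b^2), so the multipliers are real and
    positive; lam is the smaller one. *)
Lemma hyperbolic_multiplier (b d : R) : 0 < b -> 0 < d ->
  exists lam, 0 < lam <= 1 /\ lam + / lam = 2 * b / d - 1 + d ^ 2 / b ^ 2.
Proof.
  intros Hb Hd; set (t := 2 * b / d - 1 + d ^ 2 / b ^ 2).
  assert (Ht : 2 <= t).
  { assert (t - 2 = (d - b) ^ 2 * (d + 2 * b) / (d * b ^ 2)) by (unfold t; field; lra).
    assert (0 <= (d - b) ^ 2 * (d + 2 * b) / (d * b ^ 2)); [|lra].
    apply Rdiv_le_0_compat; [|apply Rmult_lt_0_compat; nra].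
    apply Rmult_le_pos; [apply pow2_ge_0|lra]. }
  set (s := sqrt (t ^ 2 - 4)).
  assert (Hs0 : 0 <= s) by apply sqrt_pos.
  assert (Hs : s ^ 2 = t ^ 2 - 4) by (unfold s; rewrite pow2_sqrt; nra).
  assert (Hst : s < t) by nra.
  exists ((t - s) / 2); split; [split; [lra|]|].
  - apply Rnot_lt_le; intros Hc; nra.
  - replace (/ ((t - s) / 2)) with ((t + s) / 2); [lra|].
    apply Rmult_eq_reg_l with ((t - s) / 2); [|lra]; rewrite Rinv_r by lra; nra.
Qed.

(** The values of h along a cell at E = k = 0: a fixed point of the recursion with g = 0, its
    contraction condition, and the positivity of the share of the half-line in Theta. The term H1 /
    2 is its half of the contribution of the interface bond's phase. *)
Definition half_line_data (b d H1 H2 H3 : R) : Prop :=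
  H1 <> 0 /\ H2 <> 0 /\ H3 <> 0 /\
  H1 = b - b ^ 2 / H2 /\ H2 = d - b ^ 2 / H3 /\ H3 = b - d ^ 2 / H1 /\
  b ^ 2 / H2 ^ 2 * (b ^ 2 / H3 ^ 2) * (d ^ 2 / H1 ^ 2) < 1 /\
  0 < (b ^ 2 / H2 ^ 2 * d + b ^ 2 / H2 ^ 2 * (b ^ 2 / H3 ^ 2) * (d ^ 2 / H1)) /
      (1 - b ^ 2 / H2 ^ 2 * (b ^ 2 / H3 ^ 2) * (d ^ 2 / H1 ^ 2)) + H1 / 2.

(** With g = 0, each H is minus the bond to the left times the ratio of the value at the left
    neighbour to the value at the site; the site equations are then the recursion. For H1 that term
    is replaced by b x + b y through the site-1 equation. *)
Lemma half_line_data_of_bloch_mode (b d lam x y z : R) : 0 < b -> 0 < d -> 0 < lam < 1 ->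
  x <> 0 -> y <> 0 -> z <> 0 ->
  b * x + d * y + b * z = 0 -> d * (lam * x) + b * y + b * z = 0 ->
  lam * (b * x + b * y) + d * z = 0 ->
  half_line_data b d ((b * x + b * y) / x) (- b * x / y) (- b * y / z).
Proof.
  intros Hb Hd Hl Nx Ny Nz E2 E3 E1.
  assert (NF : b * x + b * y <> 0).
  { intros HF; rewrite HF, Rmult_0_r, Rplus_0_l in E1.
    apply Rmult_integral in E1; destruct E1; lra. }
  assert (HdF : d / (b * x + b * y) = - lam / z).
  { apply Rmult_eq_reg_r with (z * (b * x + b * y)); [|now apply Rmult_integral_contrapositive].
    transitivity (d * z); [field; auto|].
    transitivity (- lam * (b * x + b * y)); [lra|field; auto]. }
  assert (Q1 : b ^ 2 / (- b * x / y) ^ 2 = (y / x) ^ 2) by (field; repeat split; auto; lra).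
  assert (Q2 : b ^ 2 / (- b * y / z) ^ 2 = (z / y) ^ 2) by (field; repeat split; auto; lra).
  assert (Q3 : d ^ 2 / ((b * x + b * y) / x) ^ 2 = (lam * x / z) ^ 2).
  { transitivity ((d / (b * x + b * y) * x) ^ 2); [field; auto|]; rewrite HdF; field; auto. }
  assert (Q4 : d ^ 2 / ((b * x + b * y) / x) = - lam * d * x / z).
  { transitivity (d * (d / (b * x + b * y)) * x); [field; auto|]; rewrite HdF; field; auto. }
  unfold half_line_data; rewrite Q1, Q2, Q3, Q4.
  (* The three squared ratios telescope around the cell to the squared multiplier. *)
  replace ((y / x) ^ 2 * (z / y) ^ 2 * (lam * x / z) ^ 2) with (lam ^ 2) by (field; auto).
  assert (Hl2 : lam ^ 2 < 1) by nra.
  assert (Nb : b <> 0) by lra.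
  assert (Hquot : forall u v, u <> 0 -> v <> 0 -> - b * u / v <> 0).
  { intros u v Hu Hv; unfold Rdiv; repeat apply Rmult_integral_contrapositive_currified; auto using Rinv_neq_0_compat.
    lra. }
  repeat split; auto.
  - unfold Rdiv; apply Rmult_integral_contrapositive_currified; auto using Rinv_neq_0_compat.
  - field; auto.
  - apply Rmult_eq_reg_r with y; auto.
    transitivity (- b * x); [field; auto|]; transitivity (d * y + b * z); [lra|field; auto].
  - apply Rmult_eq_reg_r with z; auto.
    transitivity (- b * y); [field; auto|]; transitivity (b * z + d * (lam * x)); [lra|field; auto].
  - assert (Hx2 : 0 < x ^ 2) by (apply pow2_gt_0; auto).
    assert (Hpos : 0 < b * (x ^ 2 + z ^ 2 - y * (x + z))).
    { apply Rmult_lt_0_compat; auto.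
      assert (- (d * (y * (x + z))) = b * (x + z) ^ 2).
      { replace (- (d * (y * (x + z)))) with (- (d * y) * (x + z)) by ring.
        replace (d * y) with (- (b * (x + z))) by lra; ring. }
      assert (0 <= b * (x + z) ^ 2) by (apply Rmult_le_pos; [lra|apply pow2_ge_0]).
      assert (y * (x + z) <= 0) by nra.
      pose proof (pow2_ge_0 z); lra. }
    (* This is the gauge-symmetric form of the first-order energy of the cell. *)
    assert (Hid : ((y / x) ^ 2 * d + (y / x) ^ 2 * (z / y) ^ 2 * (- lam * d * x / z)) / (1 - lam ^ 2) +
        (b * x + b * y) / x / 2 = b * (x ^ 2 + z ^ 2 - y * (x + z)) / (2 * x ^ 2 * (1 - lam ^ 2))).
    { assert (Hnum : 2 * (d * y ^ 2 - lam * d * x * z) + (1 - lam ^ 2) * (b * x + b * y) * x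
         = b * (x ^ 2 + z ^ 2 - y * (x + z))).
      { replace (2 * (d * y ^ 2 - lam * d * x * z) + (1 - lam ^ 2) * (b * x + b * y) * x) with
          (2 * (d * y) * y - 2 * (d * (lam * x)) * z + (b * x + b * y) * x - lam * (b * x + b * y) * (lam * x)) by ring.
        replace (lam * (b * x + b * y)) with (- (d * z)) by lra.
        replace (- (d * z) * (lam * x)) with (- (d * (lam * x)) * z) by ring.
        replace (d * (lam * x)) with (- b * (y + z)) by lra.
        replace (d * y) with (- b * (x + z)) by lra; ring. }
      rewrite <- Hnum; field; repeat split; auto; lra. }
    rewrite Hid; apply Rdiv_lt_0_compat; auto; apply Rmult_lt_0_compat; nra.
Qed.

(** The pair (p1, F) with F = b p1 + b p2 evolves by a transfer matrix of determinant 1. Both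
    coordinates obey its recurrence and tend to 0, so the mode is a Bloch mode with multiplier lam.
    Decay excludes lam = 1, and this in turn keeps every component from vanishing. *)
Lemma half_line_data_of_zero_mode (b d : R) (p1 p2 p3 : nat -> R) : 0 < b -> 0 < d ->
  half_line_zero_mode b d p1 p2 p3 -> is_lim_seq p1 0 -> is_lim_seq p2 0 ->
  ~ (p1 O = 0 /\ p2 O = 0) ->
  p1 O <> 0 /\ exists H1 H2 H3, half_line_data b d H1 H2 H3 /\ H1 * p1 O = b * p1 O + b * p2 O.
Proof.
  intros Hb Hd [E2 E3 E1] L1 L2 Hne.
  destruct (hyperbolic_multiplier b d Hb Hd) as [lam [Hl Ht]].
  set (F := fun n => b * p1 n + b * p2 n).
  assert (P2 : forall n, p2 n = F n / b - p1 n) by (intros n; unfold F; field; lra).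
  assert (P3 : forall n, p3 n = (d / b - 1) * p1 n - d / b ^ 2 * F n).
  { intros n; apply Rmult_eq_reg_l with b; [|lra]; unfold F.
    replace (b * p3 n) with (- (b * p1 n + d * p2 n)) by (specialize (E2 n); lra); field; lra. }
  assert (R1 : forall n, p1 (S n) = (2 * b / d - 1) * p1 n + (/ b - / d) * F n).
  { intros n; apply Rmult_eq_reg_l with d; [|lra].
    replace (d * p1 (S n)) with (- (b * (p2 n + p3 n))) by (specialize (E3 n); lra).
    rewrite P3, P2; field; lra. }
  assert (R2 : forall n, F (S n) = (d - d ^ 2 / b) * p1 n + d ^ 2 / b ^ 2 * F n).
  { intros n; replace (F (S n)) with (- (d * p3 n)) by (unfold F; specialize (E1 n); lra).
    rewrite P3; field; lra. }
  assert (LF : is_lim_seq F 0).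
  { replace (Finite 0) with (Finite (b * 0 + b * 0)) by (f_equal; ring).
    apply is_lim_seq_plus'; [apply (is_lim_seq_scal_l p1 b 0)|apply (is_lim_seq_scal_l p2 b 0)]; auto. }
  assert (G1 : forall n, p1 (S n) = lam * p1 n).
  { apply decaying_recurrence; auto; intros n.
    rewrite Ht, (R1 (S n)), R2, R1; field; lra. }
  assert (G2 : forall n, F (S n) = lam * F n).
  { apply decaying_recurrence; auto; intros n.
    rewrite Ht, (R2 (S n)), R1, R2; field; lra. }
  assert (HneF : ~ (p1 O = 0 /\ F O = 0)).
  { intros [A B]; apply Hne; split; auto; rewrite P2, A, B; field; lra. }
  assert (Hl1 : lam <> 1).
  { intros ->; apply HneF; split; apply constant_null; auto; intros n;
      [rewrite G1|rewrite G2]; ring. }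
  specialize (R1 O); specialize (R2 O); specialize (G1 O) as K1; specialize (G2 O) as K2.
  rewrite K1 in R1; rewrite K2 in R2.
  assert (Nx : p1 O <> 0).
  { intros Z; rewrite Z in R1, R2; apply Hl1.
    assert (NF : F O <> 0) by tauto.
    assert (Hbd : (/ b - / d) * F O = 0) by lra.
    apply Rmult_integral in Hbd; destruct Hbd as [Hbd|]; [|contradiction].
    assert (b = d) by (apply Rinv_eq_reg; lra); subst d.
    apply Rmult_eq_reg_r with (F O); auto; rewrite R2; field; lra. }
  assert (NF : F O <> 0).
  { intros Z; rewrite Z in R1, R2; apply Hl1.
    assert (Hbd : (d - d ^ 2 / b) * p1 O = 0) by lra.
    apply Rmult_integral in Hbd; destruct Hbd as [Hbd|]; [|contradiction].
    assert (b = d).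
    { apply Rmult_eq_reg_l with (d / b); [|apply Rgt_not_eq, Rdiv_lt_0_compat; auto].
      transitivity d; [field; lra|]; transitivity (d ^ 2 / b); [lra|field; lra]. }
    subst d; apply Rmult_eq_reg_r with (p1 O); auto; rewrite R1; field; lra. }
  assert (Nz : p3 O <> 0).
  { intros Z; specialize (E1 O); fold (F 1%nat) in E1; rewrite K2, Z in E1.
    assert (H : lam * F O = 0) by lra; apply Rmult_integral in H; destruct H; [lra|contradiction]. }
  assert (Ny : p2 O <> 0).
  (* If p2 vanished, lam would equal both b / d and d / b, hence 1. *)
  { intros Z; assert (HF : F O = b * p1 O) by (unfold F; rewrite Z; ring).
    rewrite HF in R1, R2.
    assert (A1 : lam = b / d) by (apply Rmult_eq_reg_r with (p1 O); auto; rewrite R1; field; lra).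
    assert (A2 : lam = d / b).
    { apply Rmult_eq_reg_r with (b * p1 O); [rewrite R2; field; lra|].
      apply Rmult_integral_contrapositive_currified; auto; lra. }
    assert (lam * lam = 1) by (rewrite A1 at 1; rewrite A2; field; lra).
    apply Hl1; nra. }
  split; auto.
  exists ((b * p1 O + b * p2 O) / p1 O), (- b * p1 O / p2 O), (- b * p2 O / p3 O); split; [|field; auto].
  apply half_line_data_of_bloch_mode with lam; auto.
  - lra.
  - rewrite <- K1; apply E3.
  - fold (F O); rewrite <- K2; apply E1.
Qed.

(** * The zero mode of the whole chain *)

Record chain_zero_mode (bp bm dp dm c : R) (p1 p2 p3 : Z -> R) : Prop := {
  ch_site1 : forall n, bcoef bp bm n * p1 n + bcoef bp bm n * p2 n
    + ccoef bp bm dp dm c (n - 1) * p3 (n - 1)%Z = 0;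
  ch_site2 : forall n, bcoef bp bm n * p1 n + dcoef bp bm dp dm n * p2 n + bcoef bp bm n * p3 n = 0;
  ch_site3 : forall n, ccoef bp bm dp dm c n * p1 (n + 1)%Z + bcoef bp bm n * p2 n + bcoef bp bm n * p3 n = 0;
  ch_decay : forall p, p = p1 \/ p = p2 \/ p = p3 ->
    is_lim_seq (fun m => p (Z.of_nat m)) 0 /\ is_lim_seq (fun m => p (- Z.of_nat m - 1)%Z) 0;
  ch_nonzero : exists n, ~ (p1 n = 0 /\ p2 n = 0 /\ p3 n = 0) }.

(** The equations at the two ends of the interface bond read H1 p1(0) = - c p3(-1) and J1 p3(-1) = -
    c p1(0). Both end values are nonzero, so multiplying the equations gives H1 J1 = c^2. *)
Lemma matching_of_chain_zero_mode (bp bm dp dm c : R) (p1 p2 p3 : Z -> R) :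
  0 < bp -> 0 < bm -> 0 < bp + dp -> 0 < bm + dm -> 0 < c ->
  chain_zero_mode bp bm dp dm c p1 p2 p3 ->
  exists H1 H2 H3 J1 J2 J3, half_line_data bp (bp + dp) H1 H2 H3 /\
    half_line_data bm (bm + dm) J1 J2 J3 /\ H1 * J1 = c ^ 2.
Proof.
  intros Hbp Hbm Hdp Hdm Hc [E1 E2 E3 L [n0 Hn0]].
  destruct (L p1 ltac:(auto)) as [L1 L1']; destruct (L p2 ltac:(auto)) as [L2 L2'];
    destruct (L p3 ltac:(auto)) as [L3 L3'].
  assert (V : half_line_zero_mode bp (bp + dp) (fun m => p1 (Z.of_nat m)) (fun m => p2 (Z.of_nat m)) (fun m => p3 (Z.of_nat m))).
  { split; intros m.
    - specialize (E2 (Z.of_nat m)); rewrite bcoef_right, dcoef_right in E2; auto.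
    - specialize (E3 (Z.of_nat m)); rewrite bcoef_right, ccoef_right in E3.
      replace (Z.of_nat m + 1)%Z with (Z.of_nat (S m)) in E3 by lia; auto.
    - specialize (E1 (Z.of_nat (S m))); rewrite bcoef_right in E1.
      replace (Z.of_nat (S m) - 1)%Z with (Z.of_nat m) in E1 by lia.
      rewrite ccoef_right in E1; auto. }
  assert (Y : half_line_zero_mode bm (bm + dm) (fun m => p3 (- Z.of_nat m - 1)%Z)
     (fun m => p2 (- Z.of_nat m - 1)%Z) (fun m => p1 (- Z.of_nat m - 1)%Z)).
  { split; intros m.
    - specialize (E2 (- Z.of_nat m - 1)%Z); rewrite bcoef_left, dcoef_left in E2; lra.
    - specialize (E1 (- Z.of_nat m - 1)%Z); rewrite bcoef_left in E1.
      replace (- Z.of_nat m - 1 - 1)%Z with (- Z.of_nat (S m) - 1)%Z in E1 by lia.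
      rewrite ccoef_left in E1; lra.
    - specialize (E3 (- Z.of_nat (S m) - 1)%Z); rewrite bcoef_left, ccoef_left in E3.
      replace (- Z.of_nat (S m) - 1 + 1)%Z with (- Z.of_nat m - 1)%Z in E3 by lia; lra. }
  assert (M1 : bp * p1 0%Z + bp * p2 0%Z = - (c * p3 (-1)%Z)).
  { specialize (E1 0%Z); unfold bcoef, ccoef in E1; simpl in E1; lra. }
  assert (M2 : bm * p3 (-1)%Z + bm * p2 (-1)%Z = - (c * p1 0%Z)).
  { specialize (E3 (-1)%Z); unfold bcoef, ccoef in E3; simpl in E3; lra. }
  (* If both end values vanished, the interface equations would kill the adjacent values of p2 as
     well, and then each half of the mode by forward recursion. *)
  assert (Hne : ~ (p1 0%Z = 0 /\ p3 (-1)%Z = 0)).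
  { intros [A B]; apply Hn0.
    destruct (Z_cases n0) as [[m ->]|[m ->]].
    - apply (half_line_zero_mode_unique _ _ _ _ _ Hbp Hdp V); auto; simpl.
      apply Rmult_eq_reg_l with bp; [rewrite A, B in M1; lra|lra].
    - destruct (half_line_zero_mode_unique _ _ _ _ _ Hbm Hdm Y) with (n := m) as [C1 [C2 C3]]; auto; simpl.
      apply Rmult_eq_reg_l with bm; [rewrite A, B in M2; lra|lra]. }
  destruct (half_line_data_of_zero_mode _ _ _ _ _ Hbp Hdp V L1 L2) as [N1 [H1 [H2 [H3 [D1 K1]]]]].
  { simpl; intros [A B]; apply Hne; split; auto; rewrite A, B in M1.
    apply Rmult_eq_reg_l with c; lra. }
  destruct (half_line_data_of_zero_mode _ _ _ _ _ Hbm Hdm Y L3' L2') as [N3 [J1 [J2 [J3 [D3 K3]]]]].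
  { simpl; intros [A B]; apply Hne; split; auto; rewrite A, B in M2.
    apply Rmult_eq_reg_l with c; lra. }
  exists H1, H2, H3, J1, J2, J3; split; [auto|split; auto].
  simpl in K1, K3, N1, N3; rewrite M1 in K1; rewrite M2 in K3.
  apply Rmult_eq_reg_r with (p1 0%Z * p3 (-1)%Z); [|now apply Rmult_integral_contrapositive].
  transitivity ((H1 * p1 0%Z) * (J1 * p3 (-1)%Z)); [ring|rewrite K1, K3; ring].
Qed.

Lemma is_lim_seq_of_sq_le (p q : nat -> R) : (forall n, p n ^ 2 <= q n) -> is_lim_seq q 0 -> is_lim_seq p 0.
Proof.
  intros H Hq; apply is_lim_seq_abs_0.
  apply (is_lim_seq_le_le (fun _ => 0) _ (fun n => sqrt (q n))).
  - intros n; split; [apply Rabs_pos|]; rewrite <- sqrt_Rsqr_abs; apply sqrt_le_1_alt.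
    unfold Rsqr; specialize (H n); simpl in H; lra.
  - apply is_lim_seq_const.
  - rewrite <- sqrt_0; apply (is_lim_seq_continuous sqrt q 0); auto.
    apply continuity_pt_sqrt; lra.
Qed.

Lemma in_l2_component_lim (u : state) (j : Idx) : in_l2 u ->
  forall p : C -> R, (forall z, p z ^ 2 <= Cmod z ^ 2) ->
  is_lim_seq (fun m => p (u (Z.of_nat m) j)) 0 /\ is_lim_seq (fun m => p (u (- Z.of_nat m - 1)%Z j)) 0.
Proof.
  intros Hu p Hp; apply ex_series_lim_0 in Hu.
  assert (Hj : forall n, Cmod (u n j) ^ 2 <= site_nsq u n).
  { intros n; unfold site_nsq.
    pose proof (pow2_ge_0 (Cmod (u n I1))); pose proof (pow2_ge_0 (Cmod (u n I2)));
    pose proof (pow2_ge_0 (Cmod (u n I3))); pose proof (pow2_ge_0 (Cmod (u n I4)));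
    pose proof (pow2_ge_0 (Cmod (u n I5))); pose proof (pow2_ge_0 (Cmod (u n I6))).
    destruct j; lra. }
  split; eapply is_lim_seq_of_sq_le; try exact Hu; intros m; simpl;
    (eapply Rle_trans; [apply Hp|]; eapply Rle_trans; [apply Hj|]);
    pose proof (site_nsq_ge0 u (Z.of_nat m)); pose proof (site_nsq_ge0 u (- Z.of_nat m - 1)); lra.
Qed.

(** At E = k = 0 the components 1, 2, 3 and 4, 5, 6 decouple and satisfy the same equations with
    real coefficients. The real or imaginary part of one of the two triples is therefore a nonzero
    real mode. *)
Lemma chain_zero_mode_of_eigenstate (bp bm dp dm c : R) (u : state) :
  in_eigenspace bp bm dp dm c 0 0 u -> nonzero_state u ->
  exists p1 p2 p3, chain_zero_mode bp bm dp dm c p1 p2 p3.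
Proof.
  intros [Hu Heq] [n0 [j0 Hn0]].
  assert (Heq0 : forall n j, HI bp bm dp dm c 0 u n j = 0%C) by (intros; rewrite Heq; ring).
  assert (Hre : forall z : C, fst z ^ 2 <= Cmod z ^ 2) by (intros z; rewrite Cmod_sq; nra).
  assert (Him : forall z : C, snd z ^ 2 <= Cmod z ^ 2) by (intros z; rewrite Cmod_sq; nra).
  assert (Hlow : forall p : C -> R, p = fst \/ p = snd ->
    ~ (p (u n0 I1) = 0 /\ p (u n0 I2) = 0 /\ p (u n0 I3) = 0) ->
    chain_zero_mode bp bm dp dm c (fun n => p (u n I1)) (fun n => p (u n I2)) (fun n => p (u n I3))).
  { intros p Hp Hne; split.
    - intros n; specialize (Heq0 n I4); unfold HI in Heq0; apply (f_equal p) in Heq0.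
      destruct Hp; subst p; simpl in Heq0; lra.
    - intros n; specialize (Heq0 n I5); unfold HI in Heq0; apply (f_equal p) in Heq0.
      unfold expi in Heq0; rewrite Ropp_0, cos_0, sin_0 in Heq0.
      destruct Hp; subst p; simpl in Heq0; lra.
    - intros n; specialize (Heq0 n I6); unfold HI in Heq0; apply (f_equal p) in Heq0.
      unfold expi in Heq0; rewrite cos_0, sin_0 in Heq0.
      destruct Hp; subst p; simpl in Heq0; lra.
    - intros q [-> | [-> | ->]]; apply (in_l2_component_lim u _ Hu); destruct Hp; subst p; auto.
    - exists n0; auto. }
  assert (Hup : forall p : C -> R, p = fst \/ p = snd ->
    ~ (p (u n0 I4) = 0 /\ p (u n0 I5) = 0 /\ p (u n0 I6) = 0) ->
    chain_zero_mode bp bm dp dm c (fun n => p (u n I4)) (fun n => p (u n I5)) (fun n => p (u n I6))).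
  { intros p Hp Hne; split.
    - intros n; specialize (Heq0 n I1); unfold HI in Heq0; apply (f_equal p) in Heq0.
      unfold expi in Heq0; rewrite Ropp_0, cos_0, sin_0 in Heq0.
      destruct Hp; subst p; simpl in Heq0; lra.
    - intros n; specialize (Heq0 n I2); unfold HI in Heq0; apply (f_equal p) in Heq0.
      unfold expi in Heq0; rewrite cos_0, sin_0 in Heq0.
      destruct Hp; subst p; simpl in Heq0; lra.
    - intros n; specialize (Heq0 n I3); unfold HI in Heq0; apply (f_equal p) in Heq0.
      destruct Hp; subst p; simpl in Heq0; lra.
    - intros q [-> | [-> | ->]]; apply (in_l2_component_lim u _ Hu); destruct Hp; subst p; auto.
    - exists n0; auto. }
  assert (Hcomp : exists p : C -> R, (p = fst \/ p = snd) /\ p (u n0 j0) <> 0).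
  { destruct (Req_dec (fst (u n0 j0)) 0) as [A|A]; [|exists fst; auto].
    exists snd; split; auto; intros B; apply Hn0; apply injective_projections; auto. }
  destruct Hcomp as [p [Hp Hpn]].
  destruct j0;
    [eexists _, _, _; apply (Hlow p Hp)|eexists _, _, _; apply (Hlow p Hp)|eexists _, _, _; apply (Hlow p Hp)
    |eexists _, _, _; apply (Hup p Hp)|eexists _, _, _; apply (Hup p Hp)|eexists _, _, _; apply (Hup p Hp)];
    tauto.
Qed.

(** * The eigenvalue branch *)

Lemma strict_diff_taylor (f : Ek -> R) (L : Ek -> R) : strict_diff Ek f 0 L -> L (0, 0) = 0 ->
  exists K r, 0 <= K /\ 0 < r /\ forall E k, Rabs E + Rabs k < r ->
    Rabs (f (E, k) - L (E, k)) <= K * (Rabs E + Rabs k) ^ 2.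
Proof.
  intros [H0 [_ [K [r [K0 [r0 H]]]]]] HL; exists K, r; repeat split; auto; intros E k HE.
  specialize (H (E, k) po).
  rewrite pd_refl, H0 in H; simpl in H; rewrite HL, !Rminus_0_r in H.
  eapply Rle_trans; [apply H; auto|apply Req_le; ring].
Qed.

Lemma strict_diff_continuous_fst (f : Ek -> R) f0 L : strict_diff Ek f f0 L ->
  exists r, 0 < r /\ forall E k, Rabs E + Rabs k < r -> continuity_pt (fun t => f (t, k)) E.
Proof.
  intros Hf; destruct (strict_diff_lipschitz _ _ _ _ Hf) as [F [r [F0 [r0 HF]]]].
  exists r; split; auto; intros E k HE.
  apply (lipschitz_continuity_pt _ F E (r - (Rabs E + Rabs k))); auto; [lra|].
  intros y Hy; specialize (HF (y, k) (E, k)); simpl in HF.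
  rewrite !Rminus_0_r, Rminus_diag, Rabs_R0, Rplus_0_r in HF; apply HF; auto.
  replace y with ((y - E) + E) by ring; pose proof (Rabs_triang (y - E) E); lra.
Qed.

Lemma continuity_pt_Cmod (x y : R -> R) (t : R) : continuity_pt x t -> continuity_pt y t ->
  continuity_pt (fun s => Cmod (x s, y s)) t.
Proof.
  intros Hx Hy; unfold Cmod; simpl.
  apply (continuity_pt_comp (fun s => x s * (x s * 1) + y s * (y s * 1)) sqrt).
  - apply continuity_pt_ext with (fun s => x s * x s + y s * y s); [intros; ring|].
    apply continuity_pt_plus; apply continuity_pt_mult; auto.
  - apply continuity_pt_sqrt; nra.
Qed.

Lemma small_radius (r A : R) : 0 < r -> 0 < A -> exists dl, 0 < dl /\ forall k, Rabs k < dl -> A * Rabs k < r.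
Proof.
  intros Hr HA; exists (r / A); split; [apply Rdiv_lt_0_compat; auto|].
  intros k Hk; apply Rlt_div_r in Hk; lra.
Qed.

Lemma weyl_conic_root (w : Ek -> weyl) (Ga Th : R) (P : Ek -> Prop) : 0 < Ga -> 0 < Th ->
  weyl_diff Ek w 0 (fun z => Ga * fst z) (fun _ => 0) (fun z => Th * snd z) -> near Ek P ->
  exists dl K, 0 < dl /\ forall k, k <> 0 -> Rabs k < dl -> exists E, 0 < E /\
    Rabs (E - Th / Ga * Rabs k) <= K * k ^ 2 /\ wden (w (E, k)) = 0 /\ P (E, k).
Proof.
  intros HGa HTh [Hg [Hx Hy]] [r0 [Hr0 HP]].
  destruct (strict_diff_taylor _ _ Hg ltac:(simpl; ring)) as [Kg [rg [Kg0 [rg0 Tg]]]].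
  destruct (strict_diff_taylor _ _ Hx ltac:(simpl; ring)) as [Kx [rx [Kx0 [rx0 Tx]]]].
  destruct (strict_diff_taylor _ _ Hy ltac:(simpl; ring)) as [Ky [ry [Ky0 [ry0 Ty]]]].
  destruct (strict_diff_continuous_fst _ _ _ Hg) as [sg [sg0 Cg]].
  destruct (strict_diff_continuous_fst _ _ _ Hx) as [sx [sx0 Cx]].
  destruct (strict_diff_continuous_fst _ _ _ Hy) as [sy [sy0 Cy]].
  cbn [fst snd] in Tg, Tx, Ty.
  set (E1 := Th / Ga); assert (HE1 : 0 < E1) by (apply Rdiv_lt_0_compat; auto).
  (* A |k| bounds |E| + |k| for 0 <= E <= 2 E1 |k|, the range where the root is sought. *)
  set (A := 1 + 2 * E1); assert (HA : 0 < A) by (unfold A; lra).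
  set (Q := (Kg + Kx + Ky) * A ^ 2).
  assert (HQ : 0 <= Q) by (apply Rmult_le_pos; [lra|apply pow2_ge_0]).
  (* At E = E1 |k| - M k^2 and E1 |k| + M k^2 the term Ga E is off Th |k| by (4 Q + 1) k^2, more
     than the errors of g and |h| together, which are at most 3 Q k^2. So g - |h| changes sign. *)
  set (M := (4 * Q + 1) / Ga); assert (HM : 0 < M) by (apply Rdiv_lt_0_compat; lra).
  assert (HMG : Ga * M = 4 * Q + 1) by (unfold M; field; lra).
  assert (HEG : Ga * E1 = Th) by (unfold E1; field; lra).
  destruct (small_radius r0 A Hr0 HA) as [d0 [Hd0 D0]].
  destruct (small_radius rg A rg0 HA) as [d1 [Hd1 D1]].
  destruct (small_radius rx A rx0 HA) as [d2 [Hd2 D2]].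
  destruct (small_radius ry A ry0 HA) as [d3 [Hd3 D3]].
  destruct (small_radius sg A sg0 HA) as [d4 [Hd4 D4]].
  destruct (small_radius sx A sx0 HA) as [d5 [Hd5 D5]].
  destruct (small_radius sy A sy0 HA) as [d6 [Hd6 D6]].
  (* M |k| < E1 keeps the interval inside (0, 2 E1 |k|), so the root is positive. *)
  destruct (small_radius E1 M HE1 HM) as [d7 [Hd7 D7]].
  set (dl := Rmin (Rmin (Rmin d0 d1) (Rmin d2 d3)) (Rmin (Rmin d4 d5) (Rmin d6 d7))).
  exists dl, M; split; [unfold dl; repeat apply Rmin_glb_lt; auto|].
  intros k Hk0 Hk; unfold dl in Hk.
  apply Rlt_gt in Hk; repeat match goal with H : Rmin _ _ > _ |- _ => apply Rmin_Rgt_l in H; destruct H end.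
  specialize (D0 k ltac:(auto)); specialize (D1 k ltac:(auto)); specialize (D2 k ltac:(auto));
  specialize (D3 k ltac:(auto)); specialize (D4 k ltac:(auto)); specialize (D5 k ltac:(auto));
  specialize (D6 k ltac:(auto)); specialize (D7 k ltac:(auto)).
  assert (Hak : 0 < Rabs k) by now apply Rabs_pos_lt.
  rewrite <- (pow2_abs k); set (a := Rabs k) in *.
  assert (Ha2 : 0 < a ^ 2) by (apply pow_lt; auto).
  assert (HMa : M * a ^ 2 < E1 * a) by nra.
  assert (Hball : forall E, 0 <= E <= 2 * (E1 * a) -> Rabs E + a <= A * a).
  { intros E HE; rewrite Rabs_right by lra; unfold A; lra. }
  assert (Herr : forall K E, 0 <= K <= Kg + Kx + Ky -> 0 <= E <= 2 * (E1 * a) ->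
    K * (Rabs E + a) ^ 2 <= Q * a ^ 2).
  { intros K E HK HE; pose proof (Rabs_pos E).
    apply Rle_trans with ((Kg + Kx + Ky) * (A * a) ^ 2); [|unfold Q; apply Req_le; ring].
    apply Rmult_le_compat; try lra; [apply pow2_ge_0|].
    apply pow_incr; split; [lra|auto]. }
  assert (Hest : forall E, 0 <= E <= 2 * (E1 * a) ->
    Rabs (fst (w (E, k)) - Ga * E) <= Q * a ^ 2 /\
    Th * a - Q * a ^ 2 <= Cmod (snd (w (E, k))) <= Th * a + 2 * (Q * a ^ 2)).
  { intros E HE; specialize (Hball E HE).
    specialize (Tg E k ltac:(fold a; lra)); specialize (Tx E k ltac:(fold a; lra));
    specialize (Ty E k ltac:(fold a; lra)); fold a in Tg, Tx, Ty.
    pose proof (Herr Kg E ltac:(lra) HE); pose proof (Herr Kx E ltac:(lra) HE);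
    pose proof (Herr Ky E ltac:(lra) HE).
    rewrite Rminus_0_r in Tx.
    assert (HThk : Rabs (Th * k) = Th * a) by (rewrite Rabs_mult, (Rabs_right Th) by lra; auto).
    pose proof (Rabs_triang_inv (Th * k) (Th * k - snd (snd (w (E, k))))) as T1.
    replace (Th * k - (Th * k - snd (snd (w (E, k))))) with (snd (snd (w (E, k)))) in T1 by ring.
    rewrite (Rabs_minus_sym (Th * k)) in T1.
    pose proof (Rabs_triang (Th * k) (snd (snd (w (E, k))) - Th * k)) as T2.
    replace (Th * k + (snd (snd (w (E, k))) - Th * k)) with (snd (snd (w (E, k)))) in T2 by ring.
    pose proof (Rmax_Cmod (snd (w (E, k)))) as T3.
    pose proof (Rmax_r (Rabs (fst (snd (w (E, k))))) (Rabs (snd (snd (w (E, k)))))) as T4.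
    assert (T5 : Cmod (snd (w (E, k))) <= Rabs (fst (snd (w (E, k)))) + Rabs (snd (snd (w (E, k))))).
    { pose proof (Rabs_pos (fst (snd (w (E, k))))); pose proof (Rabs_pos (snd (snd (w (E, k))))).
      apply Rsqr_incr_0_var; [|lra]; rewrite !Rsqr_pow2.
      rewrite Cmod_sq, <- (pow2_abs (fst (snd (w (E, k))))), <- (pow2_abs (snd (snd (w (E, k))))); nra. }
    split; [lra|lra]. }
  destruct (IVT_interv (fun E => fst (w (E, k)) - Cmod (fst (snd (w (E, k))), snd (snd (w (E, k)))))
    (E1 * a - M * a ^ 2) (E1 * a + M * a ^ 2)) as [E [HE Hroot]].
  - intros E HE; specialize (Hball E ltac:(lra)).
    apply continuity_pt_minus; [apply Cg; fold a; lra|].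
    apply continuity_pt_Cmod; [apply Cx; fold a; lra|apply Cy; fold a; lra].
  - nra.
  - rewrite <- surjective_pairing; destruct (Hest (E1 * a - M * a ^ 2) ltac:(nra)) as [X1 X2].
    apply Rabs_le_between in X1.
    replace (Ga * (E1 * a - M * a ^ 2)) with (Th * a - (4 * Q + 1) * a ^ 2) in X1 by (rewrite <- HMG, <- HEG; ring).
    nra.
  - rewrite <- surjective_pairing; destruct (Hest (E1 * a + M * a ^ 2) ltac:(nra)) as [X1 X2].
    apply Rabs_le_between in X1.
    replace (Ga * (E1 * a + M * a ^ 2)) with (Th * a + (4 * Q + 1) * a ^ 2) in X1 by (rewrite <- HMG, <- HEG; ring).
    nra.
  - rewrite <- surjective_pairing in Hroot.
    exists E; split; [nra|split; [|split]].
    + apply Rabs_le; lra.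
    + unfold wden; rewrite <- (Cmod_sq (snd (w (E, k)))).
      replace (fst (w (E, k))) with (Cmod (snd (w (E, k)))) by lra; ring.
    + apply HP; simpl; rewrite !Rminus_0_r; specialize (Hball E ltac:(lra)); fold a; lra.
Qed.

Theorem theorem10 (bp bm dp dm c : R) :
  0 < bp -> 0 < bm -> 0 < bp + dp -> 0 < bm + dm -> 0 < c ->
  eigenspace_dim2 bp bm dp dm c 0 0 ->
  exists E1 : R, 0 < E1 /\
    exists delta Cst : R, 0 < delta /\
      forall k : R, k <> 0 -> Rabs k < delta ->
        exists Ep Em : R,
          Ep <> Em /\
          is_eigenvalue bp bm dp dm c k Ep /\
          is_eigenvalue bp bm dp dm c k Em /\
          Rabs (Ep - E1 * Rabs k) <= Cst * k ^ 2 /\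
          Rabs (Em + E1 * Rabs k) <= Cst * k ^ 2.
Proof.
  intros Hbp Hbm Hdp Hdm Hc [u1 [u2 [Hu1 [_ [Hind _]]]]].
  assert (Hnz : nonzero_state u1).
  { apply NNPP; intros Hn.
    assert (Hz : forall n j, u1 n j = 0%C).
    { intros n j; apply NNPP; intros Hnj; apply Hn; exists n, j; auto. }
    destruct (Hind 1%C 0%C) as [A _]; [intros n j; rewrite Hz; ring|].
    apply RtoC_inj in A; lra. }
  destruct (chain_zero_mode_of_eigenstate _ _ _ _ _ _ Hu1 Hnz) as [p1 [p2 [p3 Hch]]].
  destruct (matching_of_chain_zero_mode _ _ _ _ _ _ _ _ Hbp Hbm Hdp Hdm Hc Hch)
    as [H1 [H2 [H3 [J1 [J2 [J3 [[N1 [N2 [N3 [A1 [A2 [A3 [Hq Hth]]]]]]] [[N1' [N2' [N3' [B1 [B2 [B3 [Hq' Hth']]]]]]] HJ]]]]]]]].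
  destruct (half_line_branch bp (bp + dp) H1 H2 H3) as [wp [Wp Np]]; auto.
  destruct (half_line_branch bm (bm + dm) J1 J2 J3) as [wm [Wm Nm]]; auto.
  set (q1 := bp ^ 2 / H2 ^ 2) in *; set (q2 := bp ^ 2 / H3 ^ 2) in *; set (q3 := (bp + dp) ^ 2 / H1 ^ 2) in *.
  set (q1' := bm ^ 2 / J2 ^ 2) in *; set (q2' := bm ^ 2 / J3 ^ 2) in *; set (q3' := (bm + dm) ^ 2 / J1 ^ 2) in *.
  set (gp := (1 + q1 + q1 * q2) / (1 - q1 * q2 * q3)) in *.
  set (gm := (1 + q1' + q1' * q2') / (1 - q1' * q2' * q3')) in *.
  set (tp := (q1 * (bp + dp) + q1 * q2 * ((bp + dp) ^ 2 / H1)) / (1 - q1 * q2 * q3)) in *.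
  set (tm := (q1' * (bm + dm) + q1' * q2' * ((bm + dm) ^ 2 / J1)) / (1 - q1' * q2' * q3')) in *.
  assert (Hsq : forall x y, y <> 0 -> 0 <= x ^ 2 / y ^ 2).
  { intros x y Hy; apply Rdiv_le_0_compat; [apply pow2_ge_0|apply pow2_gt_0; auto]. }
  assert (Hgp : 0 < gp).
  { assert (0 <= q1) by (apply Hsq; auto); assert (0 <= q2) by (apply Hsq; auto).
    apply Rdiv_lt_0_compat; nra. }
  assert (Hgm : 0 < gm).
  { assert (0 <= q1') by (apply Hsq; auto); assert (0 <= q2') by (apply Hsq; auto).
    apply Rdiv_lt_0_compat; nra. }
  destruct Wp as [Wpg [Wpx Wpy]].
  assert (Hk : strict_diff Ek (fun z => snd z) 0 (fun z => snd z)) by apply strict_diff_snd.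
  (* The elimination across the interface bond; its base value H1 - c^2 / J1 is zero because H1 J1 =
     c^2. *)
  assert (WM := weyl_diff_step Ek (fun z => fst (wp z)) (fun z => snd (wp z))
    (fun z => (RtoC c * expi (- snd z / 2))%C) wm H1 c J1 _ _ _ (fun z => c * (- snd z / 2)) _ _ _ N1'
    Wpg Wpx Wpy (strict_diff_scaled_cos _ _ _ c (strict_diff_neg_half _ _ _ Hk))
    (strict_diff_scaled_sin _ _ _ c (strict_diff_neg_half _ _ _ Hk)) Wm).
  set (Ga := gp + c ^ 2 / J1 ^ 2 * gm).
  (* The phase of the interface bond contributes c^2 / J1 = H1, shared equally by the halves: c^2 /
     J1^2 times J1 / 2 is again H1 / 2. *)
  set (Th := (tp + H1 / 2) + c ^ 2 / J1 ^ 2 * (tm + J1 / 2)).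
  assert (HcJ : 0 <= c ^ 2 / J1 ^ 2) by (apply Hsq; auto).
  assert (HGa : 0 < Ga) by (unfold Ga; nra).
  assert (HTh : 0 < Th) by (unfold Th; nra).
  assert (HJc : H1 = c ^ 2 / J1) by (rewrite <- HJ; field; auto).
  destruct (weyl_conic_root
    (fun z => wstep (fst (wp z)) (snd (wp z)) (RtoC c * expi (- snd z / 2))%C (wm z)) Ga Th
    (fun z => (wden (wp z) <> 0 /\ forall a, exists v1 v2 v3,
        decaying_half_line bp (bp + dp) (fst z) (snd z) (wp z) a v1 v2 v3) /\
      (wden (wm z) <> 0 /\ forall a, exists v1 v2 v3,
        decaying_half_line bm (bm + dm) (fst z) (snd z) (wm z) a v1 v2 v3)) HGa HTh)
    as [dl [K [Hdl Hroot]]].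
  - eapply weyl_diff_ext; [| | | |exact WM]; intros; cbv beta.
    + rewrite <- HJc; ring.
    + unfold Ga; ring.
    + ring.
    + unfold Th; rewrite HJc; field; auto.
  - apply near_and; auto.
  - exists (Th / Ga); split; [apply Rdiv_lt_0_compat; auto|].
    exists dl, K; split; auto; intros k Hk0 Hkd.
    destruct (Hroot k Hk0 Hkd) as [E [HE [Hasym [Hden [[_ Vp] [Dm Vm]]]]]].
    cbn [fst snd] in Hden, Vp, Dm, Vm.
    (* The same root serves both signs s = 1 and s = -1 of [matched_eigenvalue]. *)
    exists (1 * E), (-1 * E); repeat split.
    + lra.
    + apply (matched_eigenvalue bp bm dp dm c k E 1 (wp (E, k)) (wm (E, k))); auto; ring.
    + apply (matched_eigenvalue bp bm dp dm c k E (-1) (wp (E, k)) (wm (E, k))); auto; ring.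
    + rewrite Rmult_1_l; auto.
    + replace (-1 * E + Th / Ga * Rabs k) with (- (E - Th / Ga * Rabs k)) by ring.
      rewrite Rabs_Ropp; auto.
Qed.
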